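(* Let $G\subset \mathrm{Diff}_+^2(\mathbb S^1)$ be a finitely generated subgroup with an exceptional minimal set $\Lambda$. Assume that $G$ satisfies property $(\Lambda\star)$. If there exists an atomless $\delta$-conformal measure supported on $\Lambda$, then $\delta=\dim_{\mathrm H}\Lambda$.
   Context: $\mathrm{Diff}_+^2(\mathbb S^1)$ is the group of orientation-preserving $C^2$ circle diffeomorphisms. An exceptional minimal set is a minimal nonempty closed $G$-invariant set homeomorphic to a Cantor set. $\mathrm{NE}=\{x\in\mathbb S^1: g'(x)\le1\ \forall g\in G\}$. Property $(\Lambda\star)$: $G$ admits an exceptional minimal set $\Lambda$ and for every $x\in\mathrm{NE}\cap\Lambda$ there exist $g_+,g_-\in G$ with $g_+(x)=g_-(x)=x$ such that $x$ is isolated from the right in the fixed point set $\mathrm{Fix}(g_+)$ and isolated from the left in $\mathrm{Fix}(g_-)$. A $\delta$-conformal measure is a Borel probability measure $\nu$ on $\mathbb S^1$ such that $\nu(gA)=\int_A|g'(x)|^\delta\,d\nu(x)$ for every Borel set $A$ and every $g\in G$. *)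

(* Defs.v *)
From HB Require Import structures.
From mathcomp Require Import all_boot all_order all_algebra.
From mathcomp Require Import all_classical all_reals all_analysis.
From mathcomp Require Import lra zify.
Import Order.TTheory GRing.Theory Num.Theory.
Import numFieldNormedType.Exports.

Set Implicit Arguments.
Unset Strict Implicit.
Unset Printing Implicit Defensive.

Local Open Scope quotient_scope.
Local Open Scope ring_scope.
Local Open Scope classical_set_scope.

Definition int_zmod (R : realType) : zmodClosed R :=
  GRing.ZmodClosed.clone R (@Num.int_num_subdef R) _.

Definition circle (R : realType) : Type := Quotient.quot (int_zmod R).

HB.instance Definition _ (R : realType) := GRing.Zmodule.on (circle R).

HB.instance Definition _ (R : realType) := isPointed.Build (circle R) 0.

Definition circle_proj (R : realType) (t : R) : circle R :=
  \pi_(Quotient.quot (int_zmod R)) t.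

Definition circle_coord (R : realType) (x : circle R) : R :=
  @repr _ (Quotient.quot (int_zmod R)) x.

Lemma circle_coordK (R : realType) : cancel (@circle_coord R) (@circle_proj R).
Proof. exact: reprK. Qed.

Lemma circle_proj_eq (R : realType) (s t : R) :
  (circle_proj s == circle_proj t) = (s - t \is a Num.int).
Proof. by rewrite /circle_proj -Quotient.idealrBE. Qed.

Lemma circle_projD (R : realType) (s t : R) : circle_proj (s + t) = circle_proj s + circle_proj t.
Proof. exact: Quotient.pi_add. Qed.

Lemma circle_projN (R : realType) (t : R) : circle_proj (- t) = - circle_proj t.
Proof. exact: Quotient.pi_opp. Qed.

Lemma circle_projB (R : realType) (s t : R) : circle_proj (s - t) = circle_proj s - circle_proj t.
Proof. by rewrite circle_projD circle_projN. Qed.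

Lemma circle_proj0 (R : realType) : circle_proj (0 : R) = 0.
Proof. by rewrite -(subrr (0 : R)) circle_projB subrr. Qed.

(** Arc-length distance on the circle of length 1: the quotient norm of
    [x - y]. *)
Definition circle_dist (R : realType) (x y : circle R) : R :=
  inf [set `|t| | t in [set t : R | circle_proj t = x - y]].

Lemma circle_dist_le (R : realType) (x y : circle R) (t : R) :
  circle_proj t = x - y -> circle_dist x y <= `|t|.
Proof.
by move=> h; apply: ge_inf; [exists 0 => _ [s _ <-]; exact: normr_ge0|exists t].
Qed.

Lemma circle_dist_approx (R : realType) (x y : circle R) (e : R) : 0 < e ->
  exists2 t, circle_proj t = x - y & `|t| < circle_dist x y + e.
Proof.
move=> e0; have h : has_inf [set `|t| | t in [set t : R | circle_proj t = x - y]].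
  split; last by exists 0 => _ [s _ <-]; exact: normr_ge0.
  by exists `|circle_coord (x - y)|, (circle_coord (x - y)) => //=; exact: circle_coordK.
by have [_ [t pt <-] lt] := inf_adherent e0 h; exists t.
Qed.

Lemma circle_dist_ge0 (R : realType) (x y : circle R) : 0 <= circle_dist x y.
Proof.
apply/ler_addgt0Pr => e /(circle_dist_approx x y) [t _ /ltW].
exact: le_trans.
Qed.

Lemma circle_distxx (R : realType) (x : circle R) : circle_dist x x = 0.
Proof.
apply/eqP; rewrite eq_le circle_dist_ge0 andbT -(normr0 R).
by apply: circle_dist_le; rewrite subrr circle_proj0.
Qed.

Lemma circle_dist_sym (R : realType) (x y : circle R) :
  circle_dist x y = circle_dist y x.
Proof.
suff h (u v : circle R) : circle_dist u v <= circle_dist v u.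
  by apply/eqP; rewrite eq_le !h.
apply/ler_addgt0Pr => e /(circle_dist_approx v u) [t pt /ltW]; apply: le_trans.
by rewrite -normrN; apply: circle_dist_le; rewrite circle_projN pt opprB.
Qed.

Lemma circle_dist_triangle (R : realType) (y x z : circle R) :
  circle_dist x z <= circle_dist x y + circle_dist y z.
Proof.
apply/ler_addgt0Pr => e e0; have e20 : 0 < e / 2 by rewrite divr_gt0.
have [s ps ls] := circle_dist_approx x y e20.
have [t pt lt] := circle_dist_approx y z e20.
rewrite [e]splitr addrACA; apply: le_trans (ltW (ltrD ls lt)).
apply: le_trans (ler_normD s t); apply: circle_dist_le.
by rewrite circle_projD ps pt addrA subrK.
Qed.

Lemma circle_dist_eq0 (R : realType) (x y : circle R) :
  circle_dist x y = 0 -> x = y.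
Proof.
move=> d0.
have near0 (e : R) : 0 < e -> exists2 t, circle_proj t = x - y & `|t| < e.
  by move=> /(circle_dist_approx x y); rewrite d0 add0r.
have [s ps ls] := near0 (1 / 2) ltac:(by rewrite divr_gt0).
have [s0|s0] := eqVneq s 0.
  by apply/eqP; rewrite -subr_eq0 -ps s0 circle_proj0.
have m0 : 0 < Num.min `|s| (1 / 2) by rewrite lt_min normr_gt0 s0 divr_gt0.
have [t pt] := near0 _ m0; rewrite lt_min => /andP[lts lt].
have /intrP[n sn] : s - t \is a Num.int by rewrite -circle_proj_eq ps pt.
have : `|s - t| < 1.
  by rewrite [ltRHS]splitr; apply: le_lt_trans (ler_normB _ _) (ltrD ls lt).
rewrite sn -intr_norm ltrz1 => n1.
have n0 : n = 0 by move: n1; case: (n) => [[|k]|k].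
by move: sn lts; rewrite n0 mulr0z => /eqP; rewrite subr_eq0 => /eqP ->; rewrite ltxx.
Qed.

HB.instance Definition _ (R : realType) :=
  isMetric.Build R (circle R) (@circle_distxx R) (@circle_dist_eq0 R)
    (@circle_dist_sym R) (@circle_dist_triangle R).

Definition lifts (R : realType) (F : R -> R) (g : circle R -> circle R) :=
  continuous F /\ forall t, circle_proj (F t) = g (circle_proj t).

Definition C2 (R : realType) (F : R -> R) :=
  [/\ forall t, derivable F t 1, forall t, derivable F^`() t 1
    & continuous (F^`(2))].

Definition circle_C2 (R : realType) (g : circle R -> circle R) :=
  exists2 F, lifts F g & C2 F.

Definition orientation_preserving (R : realType) (g : circle R -> circle R) :=
  exists2 F, lifts F g & {homo F : s t / s < t}.

Definition Diff2_plus (R : realType) : set (circle R -> circle R) :=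
  [set g | [/\ circle_C2 g, orientation_preserving g
    & exists h, [/\ cancel g h, cancel h g & circle_C2 h]]].

(** The choices of a lift and of a representative do not matter, see
    [circle_deriveE]. *)
Definition circle_derive (R : realType) (g : circle R -> circle R)
    (x : circle R) : R :=
  derive1 (xget (idfun : R -> R) [set F | lifts F g] : R -> R) (circle_coord x).

Lemma int_valued_continuous_cst (R : realType) (D : R -> R) :
  continuous D -> (forall t, D t \is a Num.int) -> forall s t, D s = D t.
Proof.
move=> cD iD; suff H s t : s <= t -> D s = D t.
  by move=> s t; have [/H//|/ltW/H] := leP s t.
move=> st; apply/eqP/negPn/negP => nst.
have [m Em] : exists m : int, Num.min (D s) (D t) = m%:~R.
  by apply/intrP; rewrite minEle; case: ifP.
have [n En] : exists n : int, Num.max (D s) (D t) = n%:~R.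
  by apply/intrP; rewrite maxEle; case: ifP.
have mn : (m%:~R : R) < n%:~R.
  by rewrite -Em -En minEle maxEle; move: nst; case: (ltgtP (D s) (D t)).
have : (m + 1)%:~R <= (n%:~R : R) by rewrite ler_int lezD1 -(ltr_int R).
rewrite intrD => mn1.
have [|c _ Dc] := @IVT R D s t (m%:~R + 2^-1) st (continuous_subspaceT cD).
  by rewrite Em En; apply/andP; split; lra.
have /intrP[k] := iD c; rewrite Dc => E.
have l1 : (m%:~R : R) < k%:~R by rewrite -E; lra.
have l2 : (k%:~R : R) < (m + 1)%:~R by rewrite -E intrD; lra.
by move: l1 l2; rewrite !ltr_int; lia.
Qed.

Lemma circle_deriveE (R : realType) (g : circle R -> circle R) (F : R -> R) t :
  lifts F g -> circle_derive g (circle_proj t) = derive1 F t.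
Proof.
move=> lF; rewrite /circle_derive.
case: xgetP => [F1 _ lF1|/(_ F)/(_ lF)//].
have [cF gF] := lF; have [cF1 gF1] := lF1.
set n := circle_coord (circle_proj t) - t.
have nint : circle_proj (circle_coord (circle_proj t)) = circle_proj t by rewrite circle_coordK.
have pn : circle_proj n = 0 by rewrite circle_projB nint subrr.
have e s : F1 (s + n) - F s = F1 (0 + n) - F 0.
  apply: (@int_valued_continuous_cst _ (fun s => F1 (s + n) - F s)).
    move=> u; apply: cvgB; last exact: cF.
    apply: (@continuous_comp _ _ _ (fun v => v + n) F1); last exact: cF1.
    exact: (cvgD (@cvg_id _ (nbhs u)) (cvg_cst n)).
  by move=> u; rewrite -circle_proj_eq gF gF1 circle_projD pn addr0.
have -> : circle_coord (circle_proj t) = t + n by rewrite addrC subrK.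
rewrite /derive1.
suff -> : (fun h : R => h^-1 *: (F1 (h + (t + n)) - F1 (t + n))) =
          (fun h : R => h^-1 *: (F (h + t) - F t)) by [].
apply/funext => h; congr (_ *: _).
by move: (e t) (e (h + t)); rewrite -(addrA h t n) => e1 e2; lra.
Qed.

Definition subgroup_Diff2_plus (R : realType)
    (G : set (circle R -> circle R)) :=
  [/\ G `<=` @Diff2_plus R, G idfun,
     forall g h, G g -> G h -> G (g \o h)
   & forall g h, G g -> cancel g h -> cancel h g -> G h].

Definition finitely_generated (R : realType)
    (G : set (circle R -> circle R)) :=
  exists2 S, finite_set S & G = smallest (@subgroup_Diff2_plus R) S.

Definition invariant_set (R : realType) (G : set (circle R -> circle R))
    (A : set (circle R)) :=
  forall g, G g -> g @` A = A.

Definition minimal_set (R : realType) (G : set (circle R -> circle R))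
    (A : set (circle R)) :=
  [/\ A !=set0, closed A, invariant_set G A
    & forall B, B `<=` A -> B !=set0 -> closed B -> invariant_set G B -> B = A].

Definition homeomorphic_to (S T : topologicalType) (A : set T) :=
  exists (f : S -> T) (h : T -> S),
    [/\ continuous f, {within A, continuous h}, forall s, A (f s),
        cancel f h & forall t, A t -> f (h t) = t].

Definition exceptional_minimal_set (R : realType)
    (G : set (circle R -> circle R)) (A : set (circle R)) :=
  minimal_set G A /\ homeomorphic_to cantor_space A.

Definition NE (R : realType) (G : set (circle R -> circle R)) :
    set (circle R) :=
  [set x | forall g, G g -> circle_derive g x <= 1].

Definition fixed_points (T : Type) (g : T -> T) : set T := [set x | g x = x].

Definition isolated_right (R : realType) (A : set (circle R)) (x : circle R) :=
  \forall t \near (0 : R)^'+, ~ A (x + circle_proj t).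

Definition isolated_left (R : realType) (A : set (circle R)) (x : circle R) :=
  \forall t \near (0 : R)^'+, ~ A (x - circle_proj t).

Definition property_Lambda_star (R : realType)
    (G : set (circle R -> circle R)) (L : set (circle R)) :=
  exceptional_minimal_set G L /\
  forall x, (NE G `&` L) x -> exists gp gm,
    [/\ G gp, G gm, gp x = x & gm x = x] /\
    (isolated_right (fixed_points gp) x /\ isolated_left (fixed_points gm) x).

Definition borel_circle (R : realType) :=
  g_sigma_algebraType (@open (circle R)).

Definition conformal_measure (R : realType) (G : set (circle R -> circle R))
    (delta : R) (nu : probability (borel_circle R) R) :=
  forall (g : circle R -> circle R) (A : set (borel_circle R)),
    G g -> measurable A ->
    nu (g @` A) = (\int[nu]_(x in A) (`|circle_derive g x| `^ delta)%:E)%E.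

Definition atomless (R : realType) (nu : probability (borel_circle R) R) :=
  forall x, nu [set x] = 0%E.

Definition supported_on (R : realType) (nu : probability (borel_circle R) R)
    (A : set (circle R)) :=
  nu (~` A) = 0%E.

Local Open Scope ereal_scope.

Definition mdiam (R : realType) (T : metricType R) (A : set T) : \bar R :=
  ereal_sup [set (mdist x y)%:E | x in A & y in A].

(** The empty set has weight 0 also for [s = 0], while a singleton then has
    weight [0 `^ 0 = 1]. *)
Definition hausdorff_weight (R : realType) (T : metricType R) (s : R)
    (A : set T) : \bar R :=
  if A == set0 then 0 else mdiam A `^ s.

Definition hausdorff_content (R : realType) (T : metricType R) (s e : R)
    (A : set T) : \bar R :=
  ereal_inf [set \sum_(0 <= n <oo) hausdorff_weight s (U n) |
    U in [set U : (set T)^nat |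
      A `<=` \bigcup_n U n /\ forall n, mdiam (U n) <= e%:E]].

Definition hausdorff_measure (R : realType) (T : metricType R) (s : R)
    (A : set T) : \bar R :=
  ereal_sup [set hausdorff_content s e A | e in [set e : R | (0 < e)%R]].

Definition hausdorff_dim (R : realType) (T : metricType R) (A : set T) :
    \bar R :=
  ereal_inf [set s%:E |
    s in [set s : R | (0 <= s)%R /\ hausdorff_measure s A = 0]].

(* Main.v *)
Require Import Defs.
From mathcomp Require Import all_boot all_order all_algebra.
From mathcomp Require Import all_classical all_reals all_analysis.
From mathcomp Require Import measurable_realfun ring lra.
Import Order.TTheory GRing.Theory Num.Theory.
Import numFieldNormedType.Exports.

Set Implicit Arguments.
Unset Strict Implicit.
Unset Printing Implicit Defensive.

Local Open Scope classical_set_scope.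
Local Open Scope ring_scope.

(** Write [delta] for the exponent of the conformal measure [nu]. Call a point of
    the minimal set conical if no element of the group maps it into [NE]; since
    property (Lambda star) isolates the points of [NE] from each other, all but
    countably many points are conical, and these exceptions are invisible both
    to the atomless measure and to Hausdorff measures of positive exponent.

    At a conical point the group expands forever with bounded distortion. A
    point outside [NE] is expanded by some element, by definition. A point close
    to [NE] is expanded by iterating an element fixing the nearby point of [NE]:
    the fixed point may be parabolic, but on the isolated side the fundamental
    domains are disjoint, so the sum of their lengths bounds the distortion
    ([parabolic_escape]). Compactness makes the constants uniform
    ([uniform_local_expansion]), and composing the steps gives, for a conical
    point [t], arbitrarily small scales [rho] at which the ball around [t] is an
    almost undistorted copy of an arc of definite size ([conical_zoom]).
    Conformality then yields, at these good scales, that the ball of radius [rho]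
    and its five times enlargement both have measure comparable to
    [rho `^ delta], and minimality places in that ball a copy, of comparable
    size, of one fixed piece of the minimal set ([conical_good_scales]).

    Vitali's covering lemma turns this into both bounds on the dimension. For
    [s > delta], disjoint good balls of small radius have
    [\sum rho `^ s <= eps * \sum rho `^ delta <= eps * C], and their enlargements
    cover the conical points, so the [s]-dimensional measure vanishes
    ([hausdorff_measure_above]).

    For [s < delta] good scales give no upper bound on the measure of balls at
    the remaining scales, which may fail near parabolic points, so the mass
    distribution principle does not apply. Instead, the enlargements of
    disjoint good balls carry a definite mass, so [\sum rho `^ delta] is bounded
    below and [\sum rho `^ s] becomes large as the radii shrink. Finitely many of
    the copies of the fixed piece inside these balls thus have total [s]-weight
    larger than one: they form an iterated function system on that piece, and
    a covering argument by induction on the number of sets shows that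
    the piece has nonzero Hausdorff measure for every smaller exponent
    ([separated_images_finite_cover], [hausdorff_measure_below]). *)

(** * Distortion of one-dimensional maps *)

Section Distortion.
Context {R : realType}.
Implicit Types (F H : R -> R) (a b c s t y K M : R).

Definition pos_derivable F := forall t, derivable F t 1 /\ 0 < derive1 F t.

(** The logarithm turns the chain rule into a sum, so that these constants can be
    added up along compositions. *)
Definition log_lipschitz K a b F := forall s t,
  s \in `[a, b] -> t \in `[a, b] ->
  `|ln (derive1 F s) - ln (derive1 F t)| <= K * `|s - t|.

Lemma pos_derivable_continuous F : pos_derivable F -> continuous F.
Proof.
move=> dF t; apply/differentiable_continuous/derivable1_diffP.
by have [] := dF t.
Qed.

Lemma pos_derivable_mvt F s t : pos_derivable F -> s <= t ->
  exists2 c, c \in `[s, t] & F t - F s = derive1 F c * (t - s).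
Proof.
move=> dF st; apply: (@MVT_segment R F (derive1 F) s t st).
  move=> x _; rewrite derive1E; apply: DeriveDef => //; by have [] := dF x.
exact/continuous_subspaceT/pos_derivable_continuous.
Qed.

Lemma pos_derivable_lt F : pos_derivable F -> {mono F : s t / s < t}.
Proof.
move=> dF; apply: leW_mono; apply: le_mono => s t st.
have [c _ E] := pos_derivable_mvt dF (ltW st).
by rewrite -subr_gt0 E mulr_gt0 ?subr_gt0//; have [] := dF c.
Qed.

Lemma pos_derivable_le F : pos_derivable F -> {mono F : s t / s <= t}.
Proof. by move=> dF; apply: le_mono => s t; rewrite pos_derivable_lt. Qed.

Lemma derive1_pos_comp F H t : pos_derivable F -> pos_derivable H ->
  derive1 (F \o H) t = derive1 F (H t) * derive1 H t.
Proof. by move=> dF dH; rewrite (derive1_comp (dH t).1 (dF (H t)).1). Qed.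

Lemma pos_derivable_comp F H :
  pos_derivable F -> pos_derivable H -> pos_derivable (F \o H).
Proof.
move=> dF dH t; split.
  apply/derivable1_diffP; apply: differentiable_comp; apply/derivable1_diffP.
  - by have [] := dH t.
  - by have [] := dF (H t).
by rewrite derive1_pos_comp// mulr_gt0; have [] := dH t; have [] := dF (H t).
Qed.

Lemma pos_derivable_id : pos_derivable (id : R -> R).
Proof. by move=> t; split; [exact: derivable_id|rewrite derive1E derive_id]. Qed.

Lemma pos_derivable_iter F k : pos_derivable F -> pos_derivable (iter k F).
Proof.
move=> dF; elim: k => [|k IH]; first exact: pos_derivable_id.
exact: (pos_derivable_comp dF IH).
Qed.

Lemma ln_derive1_comp F H t : pos_derivable F -> pos_derivable H ->
  ln (derive1 (F \o H) t) = ln (derive1 F (H t)) + ln (derive1 H t).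
Proof.
move=> dF dH; rewrite derive1_pos_comp// lnM// posrE.
- by have [] := dF (H t).
- by have [] := dH t.
Qed.

Lemma log_lipschitz_le F K a b s t : pos_derivable F -> log_lipschitz K a b F ->
  s \in `[a, b] -> t \in `[a, b] ->
  derive1 F s <= expR (K * `|s - t|) * derive1 F t.
Proof.
move=> dF lF sI tI; have [_ Fs] := dF s; have [_ Ft] := dF t.
rewrite -(lnK Fs) -(lnK Ft) -expRD ler_expR -lerBlDr.
exact: le_trans (ler_norm _) (lF _ _ sI tI).
Qed.

(** [ln F'] has derivative [F'' / F'], which is bounded on compact
    intervals. *)
Lemma C2_log_lipschitz F a b : C2 F -> pos_derivable F ->
  exists2 K, 0 <= K & log_lipschitz K a b F.
Proof.
move=> [_ dF' cF''] dF; have [ab|ba] := leP a b; last first.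
  by exists 0 => // s t; rewrite !in_itv/= => /andP[? ?]; lra.
pose f t : R := `|derive1n 2 F t / derive1 F t|.
have cF' : continuous (derive1 F).
  by move=> t; apply/differentiable_continuous/derivable1_diffP.
have cf : continuous f.
  move=> t; apply: (@continuous_comp _ _ _ (fun t => derive1n 2 F t / derive1 F t) Num.norm).
    apply: cvgM; first exact: cF''.
    by apply: cvgV; [apply/lt0r_neq0; have [] := dF t|exact: cF'].
  exact: norm_continuous.
have [c _ fc] := EVT_max ab (continuous_subspaceT cf).
exists (f c); first exact: normr_ge0.
have key s t : s \in `[a, b] -> t \in `[a, b] -> s <= t ->
    `|ln (derive1 F s) - ln (derive1 F t)| <= f c * `|s - t|.
  rewrite !in_itv/= => /andP[a1 a2] /andP[b1 b2] st.
  have [| |e] := @MVT_segment R (@ln R \o derive1 F) (fun t => derive1n 2 F t / derive1 F t) s t st.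
  - move=> x _; have [_ Fx] := dF x.
    have -> : derive1n 2 F x / derive1 F x = (derive1 F x)^-1 * 'D_1 (derive1 F) x.
      by rewrite mulrC -derive1E.
    apply: is_derive1_comp; first exact: is_derive1_ln.
    by apply: DeriveDef.
  - apply: continuous_subspaceT => x.
    apply: continuous_comp; first exact: cF'.
    by apply: continuous_ln; have [] := dF x.
  rewrite in_itv/= => /andP[e1 e2] /= E.
  rewrite distrC E normrM [`|t - s|]distrC; apply: ler_wpM2r => //.
  by apply: fc; rewrite in_itv/=; lra.
move=> s t sI tI; have [st|/ltW ts] := leP s t; first exact: key.
by rewrite distrC [`|s - t|]distrC; exact: key.
Qed.

(** The nonlinearity of the outer map is damped by the contraction of the inner
    one. *)
Lemma log_lipschitz_comp F H K M a b c d : pos_derivable F -> pos_derivable H ->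
  log_lipschitz K a b F -> log_lipschitz M c d H -> 0 <= K ->
  forall q, 0 <= q ->
  (forall t, t \in `[c, d] -> H t \in `[a, b] /\ derive1 H t <= q) ->
  log_lipschitz (K * q + M) c d (F \o H).
Proof.
move=> dF dH lF lH K0 q q0 HI.
have key s t : s \in `[c, d] -> t \in `[c, d] -> s <= t ->
    `|H s - H t| <= q * `|s - t|.
  move=> sI tI st; have [e] := pos_derivable_mvt dH st.
  rewrite in_itv/= => /andP[e1 e2] E.
  rewrite distrC E normrM [`|t - s|]distrC; apply: ler_wpM2r => //.
  rewrite gtr0_norm; last by have [] := dH e.
  apply: (HI e _).2; move: sI tI; rewrite !in_itv/=; lra.
move=> s t sI tI; rewrite (ln_derive1_comp s dF dH) (ln_derive1_comp t dF dH).
have -> : forall p q r w : R, p + q - (r + w) = (p - r) + (q - w) by move=> *; ring.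
apply: (le_trans (ler_normD _ _)); rewrite mulrDl; apply: lerD; last exact: lH.
apply: le_trans (lF _ _ (HI s sI).1 (HI t tI).1) _.
rewrite -mulrA; apply: ler_wpM2l => //.
have [st|/ltW ts] := leP s t; first exact: key.
by rewrite distrC [`|s - t|]distrC; exact: key.
Qed.

(** * Escape from a one-sided parabolic fixed point *)

(** The fundamental domains of a map contracting towards a fixed point are
    disjoint, so the lengths of the iterates of three consecutive ones telescope
    to at most three times the length of the whole neighbourhood. *)
Lemma contraction_iter F y b : pos_derivable F -> F y = y -> y < b ->
  (forall t, y < t -> t <= b -> F t < t) ->
  forall k, [/\ y < iter k F b, iter k F b <= b, iter k.+1 F b <= iter k F b &
    \sum_(j < k) (iter j F b - iter j F (iter 3 F b)) <= 3 * (b - y)].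
Proof.
move=> dF Fy yb Fl.
have h k : [/\ y < iter k F b, iter k F b <= b & iter k.+1 F b <= iter k F b].
  elim: k => [|k [h1 h2 h3]]; first by split => //=; apply/ltW/Fl.
  have h0 : y < iter k.+1 F b by rewrite -{1}Fy /= pos_derivable_lt.
  by split => //; [exact: le_trans h3 h2|apply/ltW/Fl => //; exact: le_trans h3 h2].
move=> k; have [h1 h2 h3] := h k; split => //.
have [p1 _ _] := h k.+1; have [p2 _ _] := h k.+2.
have [_ q1 _] := h 1; have [_ q2 _] := h 2.
suff -> : \sum_(j < k) (iter j F b - iter j F (iter 3 F b)) =
  (b + iter 1 F b + iter 2 F b) - (iter k F b + iter k.+1 F b + iter k.+2 F b).
  lra.
elim: (k) => [|m IH]; first by rewrite big_ord0 /=; ring.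
rewrite big_ord_recr IH /= -/(iter 3 F b) -!iterSr /=; ring.
Qed.

Lemma log_derive1_iter_lipschitz F M a b k : pos_derivable F -> log_lipschitz M a b F ->
  forall s t, (forall j, iter j F s \in `[a, b] /\ iter j F t \in `[a, b]) ->
  `|ln (derive1 (iter k F) s) - ln (derive1 (iter k F) t)| <=
    M * \sum_(j < k) `|iter j F s - iter j F t|.
Proof.
move=> dF lF s t I; elim: k => [|k IH].
  rewrite big_ord0 mulr0 !derive1E /=.
  by rewrite !derive_id subrr normr0.
rewrite big_ord_recr mulrDr /=.
have dk := pos_derivable_iter k dF.
rewrite (ln_derive1_comp s dF dk) (ln_derive1_comp t dF dk).
have -> : forall p q r w : R, p + q - (r + w) = (q - w) + (p - r) by move=> *; ring.
apply: (le_trans (ler_normD _ _)); apply: lerD => //.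
by have [? ?] := I k; exact: lF.
Qed.

(** Otherwise the infimum of the orbit would be another fixed point. *)
Lemma iter_near_fixed_point F y b : pos_derivable F -> F y = y -> y < b ->
  (forall t, y < t -> t <= b -> F t < t) ->
  forall e, 0 < e -> exists k, iter k F b < y + e.
Proof.
move=> dF Fy yb Fl e e0; apply: contrapT => /forallNP N.
have h k := contraction_iter dF Fy yb Fl k.
pose A := [set iter k F b | k in @setT nat].
have infA : has_inf A.
  by split; [exists b; exists 0%N|exists y => _ [k _ <-]; have [/ltW] := h k].
pose l := inf A.
have ly : y + e <= l.
  apply: lb_le_inf; first by exists b; exists 0%N.
  by move=> _ [k _ <-]; rewrite leNgt; apply/negP/N.
have lA k : l <= iter k F b by apply: ge_inf; [exact: infA.2|exists k].
have Fll : F l < l by apply: Fl; [lra|exact: (lA 0%N)].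
have e1 : 0 < l - F l by rewrite subr_gt0.
have /cvgrPdist_lt/(_ _ e1)/nbhs_ballP[d /= d0 dB] : F @ l --> F l.
  exact: pos_derivable_continuous.
have [_ [k _ <-] lk] := inf_adherent d0 infA.
have := dB (iter k F b); rewrite /ball /= => /(_ _).
have -> : `|l - iter k F b| < d.
  by rewrite distrC ger0_norm ?subr_ge0//; rewrite -/l in lk; lra.
move=> /(_ isT); rewrite ltr_norml => /andP[g1 g2].
by have := lA k.+1 => /=; lra.
Qed.

(** Points near a topologically attracting side of a fixed point are carried far
    away by the inverse iterates, and the inverse of this escape contracts
    strongly with bounded distortion at a definite scale [c]. The distortion is
    controlled by the total length of the iterates of three fundamental domains
    [iter 3 F b, b], rather than by a rate of contraction. *)
Lemma parabolic_escape F y b M : pos_derivable F -> F y = y -> y < b ->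
  (forall t, y < t -> t <= b -> F t < t) -> 0 <= M -> log_lipschitz M y b F ->
  exists K c, [/\ 0 <= K, 0 < c & forall q, 0 < q -> exists2 e, 0 < e &
    forall t, y < t -> t < y + e -> exists k u, [/\ iter k F u = t,
      log_lipschitz K (u - c) (u + c) (iter k F) & derive1 (iter k F) u <= q]].
Proof.
move=> dF Fy yb Fl M0 lF.
have h k := contraction_iter dF Fy yb Fl k.
have diter k := pos_derivable_iter k dF.
pose B3 := iter 3 F b; pose S := 3 * (b - y).
have [y3 _ h34 _] := h 3; have [y2 _ _ _] := h 2; have [y1 b1 _ _] := h 1%N.
have F1 : iter 1 F b < b by exact: Fl.
have F2 : iter 2 F b < iter 1 F b by apply: Fl.
have F3 : B3 < iter 2 F b by apply: (Fl (iter 2 F b)) => //; exact/ltW/(lt_trans F2).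
have yk k : iter k F y = y by elim: k => //= k ->.
have inX k s : s \in `[B3, b] ->
    [/\ iter k F B3 <= iter k F s, iter k F s <= iter k F b & iter k F s \in `[y, b]].
  rewrite in_itv/= => /andP[s1 s2].
  have z1 : iter k F B3 <= iter k F s by rewrite (pos_derivable_le (diter k)).
  have z2 : iter k F s <= iter k F b by rewrite (pos_derivable_le (diter k)).
  split => //; rewrite in_itv/=; have [_ q1 _ _] := h k; apply/andP; split; last lra.
  rewrite -(yk k) (pos_derivable_le (diter k)); rewrite /B3 in s1; lra.
have S0 : 0 <= S by rewrite /S; lra.
have dist1 k s t : s \in `[B3, b] -> t \in `[B3, b] ->
    derive1 (iter k F) s <= expR (M * S) * derive1 (iter k F) t.
  move=> sI tI; have [_ ps] := diter k s; have [_ pt] := diter k t.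
  rewrite -(lnK ps) -(lnK pt) -expRD ler_expR -lerBlDr.
  apply: le_trans (ler_norm _) _.
  apply: le_trans (@log_derive1_iter_lipschitz F M y b k dF lF s t _) _.
    by move=> j; have [_ _ ?] := inX j s sI; have [_ _ ?] := inX j t tI.
  apply: ler_wpM2l => //; have [_ _ _ hk] := h k.
  apply: le_trans hk; apply: ler_sum => j _.
  have [? ? _] := inX j s sI; have [? ? _] := inX j t tI.
  by rewrite -/B3 ler_norml; apply/andP; split; lra.
pose X := b - B3; have X0 : 0 < X by rewrite /X; lra.
have der_len k s : s \in `[B3, b] ->
    derive1 (iter k F) s <= expR (M * S) / X * (iter k F b - iter k F B3).
  move=> sI; have [|c cI ->] := @pos_derivable_mvt (iter k F) B3 b (diter k).
    by rewrite /X in X0; lra.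
  rewrite -/X [_ * X]mulrC mulrA divfK ?gt_eqF//.
  exact: dist1.
have key j s t : s \in `[B3, b] -> t \in `[B3, b] -> s <= t ->
    `|iter j F s - iter j F t| <=
    expR (M * S) / X * (iter j F b - iter j F B3) * `|s - t|.
  move=> sI tI st; have [e] := pos_derivable_mvt (diter j) st.
  rewrite in_itv/= => /andP[e1 e2] E.
  rewrite distrC E normrM [`|t - s|]distrC; apply: ler_wpM2r => //.
  rewrite gtr0_norm; last by have [] := diter j e.
  by apply: der_len; move: sI tI; rewrite !in_itv/=; lra.
pose K := M * (expR (M * S) / X * S).
have eX0 : 0 <= expR (M * S) / X by rewrite divr_ge0 ?expR_ge0// ltW.
have lK k : log_lipschitz K B3 b (iter k F).
  move=> s t sI tI.
  apply: le_trans (@log_derive1_iter_lipschitz F M y b k dF lF s t _) _.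
    by move=> j; have [_ _ ?] := inX j s sI; have [_ _ ?] := inX j t tI.
  rewrite /K -mulrA; apply: ler_wpM2l => //.
  have [_ _ _ hk] := h k.
  apply: (@le_trans _ _ (\sum_(j < k) expR (M * S) / X * (iter j F b - iter j F B3) * `|s - t|)).
    apply: ler_sum => j _.
    have [st|/ltW ts] := leP s t; first exact: key.
    by rewrite distrC [`|s - t|]distrC; exact: key.
  by rewrite -mulr_suml -mulr_sumr; apply: ler_wpM2r => //; apply: ler_wpM2l.
(* the margin left around the middle fundamental domain *)
pose c := Num.min (b - iter 1 F b) (iter 2 F b - B3).
have c0 : 0 < c by rewrite /c lt_min; apply/andP; split; lra.
exists K, c; split => //; first by apply: mulr_ge0 => //; exact: mulr_ge0.
move=> q q0.
pose e0 := q / (expR (M * S) / X).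
have eX1 : 0 < expR (M * S) / X by rewrite divr_gt0 ?expR_gt0.
have e00 : 0 < e0 by rewrite /e0 divr_gt0.
have [N HN] := iter_near_fixed_point dF Fy yb Fl e00.
have [yN _ _ _] := h N.+1.
exists (iter N.+1 F b - y); first by rewrite subr_gt0.
move=> t yt; rewrite addrC subrK => tN.
have ex : exists k, iter k F b < t.
  have ty0 : 0 < t - y by rewrite subr_gt0.
  have [k] := iter_near_fixed_point dF Fy yb Fl ty0.
  by rewrite addrC subrK; exists k.
have [k kt kmin] := ex_minnP ex.
have mono m n : (m <= n)%N -> iter n F b <= iter m F b.
  move=> mn; rewrite -(subnK mn); elim: (n - m)%N => [|i IH]; first by rewrite add0n.
  by apply: le_trans IH; have [_ _] := h (i + m)%N.
have Nk : (N.+1 < k)%N.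
  by rewrite ltnNge; apply/negP => /mono; lra.
case: k kt kmin Nk => // k kt kmin; rewrite ltnS => Nk.
case: k kt kmin Nk => // k kt kmin; rewrite ltnS => Nk.
have kt' : t <= iter k.+1 F b.
  by rewrite leNgt; apply/negP => /kmin; rewrite ltnn.
(* [t] lies between [F^(k+2) b] and [F^(k+1) b], hence is [F^k u] for some [u]
   between [F^2 b] and [F b]. *)
have [|u uI Eu] := @IVT R (iter k F) (iter 2 F b) (iter 1 F b) t (ltW F2)
  (continuous_subspaceT (pos_derivable_continuous (diter k))).
  have E2 : iter k F (iter 2 F b) = iter k.+2 F b by rewrite -iterD addn2.
  have E1 : iter k F (iter 1 F b) = iter k.+1 F b by rewrite -iterD addn1.
  rewrite E1 E2.
  have [_ _ hh _] := h k.+1.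
  rewrite minEle maxEle; move: hh; rewrite -/(iter k.+2 F b) => hh.
  by rewrite hh (ltW kt) kt'.
move: uI; rewrite in_itv/= -/(iter 2 F b) => /andP[u1 u2].
have cm1 : c <= b - iter 1 F b by rewrite /c ge_min lexx.
have cm2 : c <= iter 2 F b - B3 by rewrite /c ge_min lexx orbT.
have u2' : u <= iter 1 F b by [].
have u1' : iter 2 F b <= u by [].
exists k, u; split => //.
  move=> s v; rewrite !in_itv/= => /andP[s1 s2] /andP[v1 v2].
  by apply: lK; rewrite in_itv/=; clear - cm1 cm2 u1' u2' s1 s2 v1 v2; lra.
have uI : u \in `[B3, b] by rewrite in_itv/=; lra.
apply: le_trans (der_len k u uI) _.
have -> : q = expR (M * S) / X * e0 by rewrite /e0 mulrC divfK// gt_eqF.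
apply: ler_wpM2l => //.
have B3I : B3 \in `[B3, b] by rewrite in_itv/= lexx /=; lra.
have [_ _] := inX k B3 B3I; rewrite in_itv/= => /andP[yB3 _].
by have := mono _ _ Nk; lra.
Qed.

End Distortion.

(** * The circle as a metric space *)

Section CircleMetric.
Context {R : realType}.
Implicit Types (s t e : R) (x y : circle R).
Local Notation proj := (@circle_proj R).

Lemma mdist_proj_le s t : mdist (proj s) (proj t) <= `|s - t|.
Proof. by apply: circle_dist_le; rewrite circle_projB. Qed.

Lemma mdist_proj_lift t x e : mdist (proj t) x < e ->
  exists2 s, `|t - s| < e & proj s = x.
Proof.
move=> d; have e0 : 0 < e - mdist (proj t) x by rewrite subr_gt0.
have [u pu] := circle_dist_approx (proj t) x e0.
rewrite -[circle_dist _ _]/(mdist (proj t) x) addrC subrK => lu.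
exists (t - u); first by rewrite opprB addrC subrK.
by rewrite circle_projB pu opprB addrC subrK.
Qed.

Lemma proj_eqP s t : proj s = proj t <-> exists n : int, s = t + n%:~R.
Proof.
split=> [/eqP|[n ->]].
  by rewrite circle_proj_eq => /intrP[n E]; exists n; rewrite -E addrC subrK.
by apply/eqP; rewrite circle_proj_eq addrAC subrr add0r; apply/intrP; exists n.
Qed.

Lemma proj_addz t (n : int) : proj (t + n%:~R) = proj t.
Proof. by apply/proj_eqP; exists n. Qed.

Lemma proj_locally_inj s t : `|s - t| < 1 -> proj s = proj t -> s = t.
Proof.
move=> st /proj_eqP[n E]; move: st.
rewrite E addrAC subrr add0r -intr_norm ltrz1 => n1.
have -> : n = 0 by move: n1; case: (n) => [[|k]|k].
by rewrite mulr0z addr0.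
Qed.

Lemma mdist_projE s t : `|s - t| <= 1 / 2 -> mdist (proj s) (proj t) = `|s - t|.
Proof.
move=> st; apply/eqP; rewrite eq_le mdist_proj_le /=.
rewrite leNgt; apply/negP => /mdist_proj_lift[u su /esym ut].
suff E : t = u by move: su; rewrite E ltxx.
apply: proj_locally_inj ut; have -> : t - u = (s - u) - (s - t) by ring.
by apply: le_lt_trans (ler_normB _ _) _; lra.
Qed.

Lemma proj_continuous : continuous proj.
Proof.
move=> t; apply/metricType_numDomainType.cvgrPdist_lt => e e0.
near=> s; apply: le_lt_trans (mdist_proj_le _ _) _.
by near: s; apply/nbhs_ballP; exists e.
Unshelve. all: by end_near. Qed.

Lemma proj_surj x (a : R) : exists2 t, t \in `[a, a + 1] & proj t = x.
Proof.
pose t := circle_coord x; have pt : proj t = x by exact: circle_coordK.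
exists (t - (Num.floor (t - a))%:~R); last first.
  rewrite -pt; apply/proj_eqP; exists (- Num.floor (t - a)).
  by rewrite intrN.
have := floor_le (t - a); have := floorD1_gt (t - a).
by rewrite intrD in_itv/= => *; apply/andP; split; lra.
Qed.

Lemma circle_compact (A : set (circle R)) : closed A -> compact A.
Proof.
move=> cA; apply: (@subclosed_compact _ A (proj @` `[0, 1])) => //.
  apply: continuous_compact; last exact: segment_compact.
  exact/continuous_subspaceT/proj_continuous.
by move=> x _; have [t] := proj_surj x 0; rewrite add0r => tI <-; exists t.
Qed.

Lemma proj_itv_closed (a b : R) : closed (proj @` `[a, b]).
Proof.
apply: compact_closed; first exact: metric_hausdorff.
apply: continuous_compact; last exact: segment_compact.
exact/continuous_subspaceT/proj_continuous.
Qed.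

Lemma closed_preimage_proj (A : set (circle R)) : closed A -> closed (proj @^-1` A).
Proof. by move=> cA; apply: closed_comp => // t _; exact: proj_continuous. Qed.

Lemma compact_uniform_scale (A : set R) (P : R -> R -> Prop) : compact A ->
  (forall e e' s, 0 < e' -> e' <= e -> P e s -> P e' s) ->
  (forall y : R, A y -> exists2 e, 0 < e & forall s, `|y - s| < e -> P e s) ->
  exists2 e, 0 < e & forall s, A s -> P e s.
Proof.
move=> cA Pmono loc.
have /compact_near_coveringP/(_ R (0 : R)^'+ P _) := cA => /(_ _)[|e /= e0 eB].
  move=> y Ay; have [e e0 he] := loc y Ay.
  exists (ball y e, [set d | 0 < d /\ d <= e]) => /=; last first.
    by move=> [s d] /= [ys [d0 de]]; apply: Pmono (he s ys).
  split; first exact: nbhsx_ballx.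
  exists e => //= d; rewrite /= sub0r normrN => de d0; split => //.
  by rewrite ltW// (le_lt_trans (ler_norm _) de).
exists (e / 2); first by rewrite divr_gt0.
move=> s As; apply: (eB (e / 2)) => //=; last by rewrite divr_gt0.
by rewrite sub0r normrN gtr0_norm ?divr_gt0//; lra.
Qed.

(** Lifts of a closed set of the circle are not compact, but properties of lifts
    are invariant under integer translations. *)
Lemma closed_uniform_scale (A : set (circle R)) (P : R -> R -> Prop) : closed A ->
  (forall e e' s, 0 < e' -> e' <= e -> P e s -> P e' s) ->
  (forall e s (n : int), P e (s + n%:~R) -> P e s) ->
  (forall y : R, A (proj y) -> exists2 e, 0 < e & forall s, `|y - s| < e -> P e s) ->
  exists2 e, 0 < e & forall s, A (proj s) -> P e s.
Proof.
move=> cA Pmono Pper loc.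
have cptA : compact (`[0, 1] `&` proj @^-1` A).
  apply: (@subclosed_compact _ _ `[(0 : R), 1]); last by move=> t [].
  - by apply: closedI; [exact: interval_closed|exact: closed_preimage_proj].
  - exact: segment_compact.
have [|e e0 he] := compact_uniform_scale cptA Pmono; first by move=> y [_]; exact: loc.
exists e => // s As; apply: (Pper _ _ (- Num.floor s)); apply: he; split.
  rewrite /= in_itv/= intrN.
  by have := floor_le s; have := floorD1_gt s; rewrite intrD => *; apply/andP; split; lra.
by rewrite /preimage /= proj_addz.
Qed.

End CircleMetric.

(** * Lifts of circle diffeomorphisms *)

Section Lifts.
Context {R : realType}.
Local Notation proj := (@circle_proj R).
Implicit Types (F H : R -> R) (g h : circle R -> circle R).

Definition monotone_lift g F := lifts F g /\ {homo F : s t / s < t}.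

Lemma lifts_cst_diff F H g : lifts F g -> lifts H g ->
  exists n : int, forall t, F t = H t + n%:~R.
Proof.
move=> [cF pF] [cH pH].
have dint t : F t - H t \is a Num.int by rewrite -circle_proj_eq pF pH.
have /intrP[n En] := dint 0; exists n => t.
have cD : continuous (fun t => F t - H t).
  by move=> u; apply: cvgB; [exact: cF|exact: cH].
by have := int_valued_continuous_cst cD dint t 0; rewrite En => <-; rewrite addrC subrK.
Qed.

Lemma lifts_addz F g (n : int) : lifts F g -> lifts (fun t => F t + n%:~R) g.
Proof.
move=> [cF pF]; split.
  by move=> t; apply: cvgD; [exact: cF|exact: cvg_cst].
by move=> t; rewrite -pF; apply/proj_eqP; exists n.
Qed.

Lemma monotone_lift_addz F g (n : int) :
  monotone_lift g F -> monotone_lift g (fun t => F t + n%:~R).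
Proof.
by move=> [lF mF]; split; [exact: lifts_addz|move=> s t /mF; rewrite ltrD2r].
Qed.

Lemma monotone_lift_comp F H g h : monotone_lift g F -> monotone_lift h H ->
  monotone_lift (g \o h) (F \o H).
Proof.
move=> [[cF pF] mF] [[cH pH] mH]; split; last by move=> s t /mH/mF.
split; last by move=> t /=; rewrite pF pH.
by move=> t; apply: continuous_comp; [exact: cH|exact: cF].
Qed.

Lemma Diff2_plus_lift g : Diff2_plus g -> exists F, monotone_lift g F.
Proof. by move=> [_ [F lF mF] _]; exists F. Qed.

Lemma derive1_add_cst F (c : R) : (forall t, derivable F t 1) ->
  derive1 (fun t => F t + c) = derive1 F.
Proof.
move=> dF; apply/funext => t; rewrite !derive1E deriveD//.
by rewrite derive_cst addr0.
Qed.

Lemma C2_add_cst F (c : R) : C2 F -> C2 (fun t => F t + c).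
Proof.
move=> [dF dF' cF'']; split.
- by move=> t; apply: derivableD.
- by rewrite (derive1_add_cst c dF); exact: dF'.
- by rewrite /derive1n /= (derive1_add_cst c dF); exact: cF''.
Qed.

Lemma circle_C2_lift g F : circle_C2 g -> lifts F g -> C2 F.
Proof.
move=> [H lH C2H] lF; have [n E] := lifts_cst_diff lF lH.
have -> : F = fun t => H t + n%:~R by exact/funext.
exact: C2_add_cst.
Qed.

(** The derivative of a lift cannot vanish because the inverse diffeomorphism
    is differentiable too. *)
Lemma Diff2_plus_pos_derivable g F : Diff2_plus g -> monotone_lift g F ->
  pos_derivable F.
Proof.
move=> [C2g _ [h [gK hK [H lH C2H]]]] [lF mF].
have C2F := circle_C2_lift C2g lF.
have dF t : derivable F t 1 by have [] := C2F.
have dH t : derivable H t 1 by have [] := C2H.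
have lHF : lifts (H \o F) idfun.
  have [cF pF] := lF; have [cH pH] := lH; split.
    by move=> t; apply: continuous_comp; [exact: cF|exact: cH].
  by move=> t /=; rewrite pH pF gK.
have lid : lifts (id : R -> R) idfun by split => // t; exact: cvg_id.
have [n E] := lifts_cst_diff lHF lid.
move=> t; split => //; rewrite lt_neqAle; apply/andP; split; last first.
  apply: (@incr_derive1_ge0 _ _ setT) => //; last by rewrite interiorT.
  by move=> s u _ _; exact: mF.
apply/eqP => F0; have : derive1 (H \o F) t = 1.
  have -> : H \o F = fun t => id t + n%:~R by exact/funext.
  by rewrite (@derive1_add_cst id _ (fun s => @derivable_id _ _ s 1)) derive1E derive_id.
rewrite derive1_comp// -F0 mulr0 => /esym/eqP.
by rewrite oner_eq0.
Qed.

Lemma monotone_lift_inverse F g h H : monotone_lift g F -> monotone_lift h H ->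
  cancel g h -> exists H', [/\ monotone_lift h H', cancel F H' & cancel H' F].
Proof.
move=> lF lH gK.
have lHF : lifts (H \o F) idfun.
  have [[lc lp] _] := monotone_lift_comp lH lF; split => // t; rewrite lp /=.
  exact: gK.
have lid : lifts (id : R -> R) idfun by split => // t; exact: cvg_id.
have [n E] := lifts_cst_diff lHF lid.
pose H' t := H t + (- n)%:~R.
have lH' : monotone_lift h H' by exact: monotone_lift_addz.
have FK : cancel F H' by move=> t; rewrite /H' -[H (F t)]/((H \o F) t) E intrN addrK.
exists H'; split => // t; have [_ mH'] := lH'.
by case: (ltgtP (F (H' t)) t) => // /mH'; rewrite FK ltxx.
Qed.

End Lifts.

(** * Groups of circle diffeomorphisms and their minimal sets *)

Section Group.
Context {R : realType} (G : set (circle R -> circle R)) (hG : subgroup_Diff2_plus G).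
Local Notation proj := (@circle_proj R).
Implicit Types (F H : R -> R) (g h : circle R -> circle R) (L V : set (circle R)).

Definition group_lift F := exists2 g, G g & monotone_lift g F.

Lemma group_inverse g : G g -> exists h, [/\ G h, cancel g h & cancel h g].
Proof.
have [GD _ _ Ginv] := hG.
move=> Gg; have [_ _ [h [gK hK _]]] := GD _ Gg.
by exists h; split => //; exact: (Ginv g).
Qed.

Lemma group_lift_ex g : G g -> exists2 F, group_lift F & monotone_lift g F.
Proof.
have [GD _ _ _] := hG.
by move=> Gg; have [F lF] := Diff2_plus_lift (GD _ Gg); exists F => //; exists g.
Qed.

Lemma group_lift_pos_derivable F : group_lift F -> pos_derivable F.
Proof.
by have [GD _ _ _] := hG; move=> [g /GD Dg lF]; exact: Diff2_plus_pos_derivable lF.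
Qed.

Lemma group_lift_C2 F : group_lift F -> C2 F.
Proof.
have [GD _ _ _] := hG.
by move=> [g /GD[C2g _ _] [lF _]]; exact: circle_C2_lift lF.
Qed.

Lemma group_lift_continuous F : group_lift F -> continuous F.
Proof. by move=> [g _ [[]]]. Qed.

Lemma group_lift_derive1_continuous F : group_lift F -> continuous (derive1 F).
Proof.
move=> /group_lift_C2[_ d2 _] t.
by apply/differentiable_continuous/derivable1_diffP.
Qed.

Lemma group_lift_comp F H : group_lift F -> group_lift H -> group_lift (F \o H).
Proof.
have [_ _ Gcomp _] := hG.
move=> [g Gg lF] [h Gh lH]; exists (g \o h); first exact: Gcomp.
exact: monotone_lift_comp.
Qed.

Lemma group_lift_id : group_lift id.
Proof. by have [_ G1 _ _] := hG; exists idfun => //; split => //; split => // t; exact: cvg_id. Qed.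

Lemma group_lift_iter F k : group_lift F -> group_lift (iter k F).
Proof.
by move=> lF; elim: k => [|k IH]; [exact: group_lift_id|exact: (group_lift_comp lF IH)].
Qed.

Lemma group_lift_addz F (n : int) : group_lift F -> group_lift (fun t => F t + n%:~R).
Proof. by move=> [g Gg lF]; exists g => //; exact: monotone_lift_addz. Qed.

Lemma group_lift_inverse F : group_lift F ->
  exists H, [/\ group_lift H, cancel F H & cancel H F].
Proof.
have [GD _ _ _] := hG.
move=> [g Gg lF]; have [h [Gh gK hK]] := group_inverse Gg.
have [H lH] := Diff2_plus_lift (GD _ Gh).
have [H' [lH' FK HK]] := monotone_lift_inverse lF lH gK.
by exists H'; split => //; exists h.
Qed.

Lemma group_lift_derive1_inverse F H t : group_lift F -> group_lift H ->
  cancel F H -> derive1 H (F t) = (derive1 F t)^-1.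
Proof.
move=> lF lH FK.
have pF := group_lift_pos_derivable lF; have pH := group_lift_pos_derivable lH.
have := derive1_pos_comp t pH pF.
have -> : H \o F = id by exact/funext.
rewrite derive1E derive_id => /esym E.
by have [_ F0] := pF t; apply: (mulIf (lt0r_neq0 F0)); rewrite E mulVf// lt0r_neq0.
Qed.

Lemma group_lift_log_lipschitz F a b : group_lift F ->
  exists2 K, 0 <= K & log_lipschitz K a b F.
Proof.
by move=> lF; apply: C2_log_lipschitz; [exact: group_lift_C2|exact: group_lift_pos_derivable].
Qed.

Lemma group_lift_invariant L F t : invariant_set G L -> group_lift F ->
  L (proj (F t)) <-> L (proj t).
Proof.
move=> iL [g Gg [[_ pF] _]]; rewrite pF; split; last first.
  by move=> Lt; rewrite -(iL g Gg); exists (proj t).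
have [h [Gh gK hK]] := group_inverse Gg.
by rewrite -{1}(iL g Gg) => -[x Lx] /(can_inj gK) <-.
Qed.

Lemma group_continuous g : G g -> continuous g.
Proof.
move=> Gg; have [F lF [[cF pF] _]] := group_lift_ex Gg.
move=> x; have [t _ <-] := proj_surj x 0.
have FF : Filter (nbhs (proj t)) by exact: nbhs_filter.
apply/(@metricType_numDomainType.cvgrPdist_lt _ _ _ _ FF) => e e0.
have /cvgrPdist_lt/(_ _ e0)/nbhs_ballP[d /= d0 dB] : F @ t --> F t by exact: cF.
apply/metricType_numDomainType.nbhs_mdistP; exists d => //= y.
move=> /mdist_proj_lift[s st <-]; rewrite -!pF.
by apply: le_lt_trans (mdist_proj_le _ _) _; exact: dB.
Qed.

(** The points of a minimal set whose orbit avoids an open set [V] form a closed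
    invariant subset. *)
Lemma minimal_orbit_meets L V x : minimal_set G L -> open V -> V `&` L !=set0 ->
  L x -> exists2 g, G g & V (g x).
Proof.
have [GD G1 Gcomp Ginv] := hG.
move=> [_ cL iL minL] oV [y [Vy Ly]] Lx; apply: contrapT => N.
pose B := L `&` [set z | forall g, G g -> ~ V (g z)].
suff /esym E : B = L by move: Ly; rewrite E => -[_ /(_ _ G1)]; apply.
apply: minL; first by move=> z [].
- by exists x; split => // g Gg Vg; apply: N; exists g.
- apply: closedI => //.
  rewrite (_ : [set z | _] = \bigcap_(g in G) ~` (g @^-1` V)); last first.
    by apply/seteqP; split => z /= Hz g Gg; exact: Hz.
  apply: closed_bigI => g Gg; apply: open_closedC; apply: open_comp => // z _.
  exact: group_continuous.
- move=> g Gg; have [h [Gh gK hK]] := group_inverse Gg.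
  have stable k z : G k -> B z -> B (k z).
    move=> Gk [Lz Nz]; split; first by rewrite -(iL k Gk); exists z.
    by move=> j Gj; apply: (Nz (j \o k)); exact: Gcomp.
  apply/seteqP; split => [_ [z Bz <-]|z Bz]; first exact: stable.
  by exists (h z) => //; exact: stable.
Qed.

Lemma minimal_lift_dense L p t e : minimal_set G L -> L (proj p) -> L (proj t) ->
  0 < e -> exists2 F, group_lift F & `|t - F p| < e.
Proof.
move=> mL Lp Lt e0.
have [|g Gg] := @minimal_orbit_meets L (ball (proj t) e)° _ mL (@open_interior _ _) _ Lp.
  by exists (proj t); split => //; exact: nbhsx_ballx.
move=> /interior_subset; rewrite ballEmdist /=.
have [F lF [[cF pF] _]] := group_lift_ex Gg.
rewrite -pF => /mdist_proj_lift[s ts /esym/proj_eqP[n E]].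
exists (fun u => F u + (- n)%:~R); first exact: group_lift_addz.
by rewrite E intrN addrK.
Qed.

End Group.

(** Words in the generators and their inverses form a countable subgroup. *)
Lemma finitely_generated_countable (R : realType) (G : set (circle R -> circle R)) :
  subgroup_Diff2_plus G -> finitely_generated G -> countable G.
Proof.
move=> hG [S finS GE]; have [GD G1 Gcomp Ginv] := hG.
have SG : S `<=` G by rewrite GE; apply: sub_smallest.
pose inv (s : circle R -> circle R) :=
  xget (idfun : circle R -> circle R) [set h | cancel s h /\ cancel h s].
have invP s : G s -> cancel s (inv s) /\ cancel (inv s) s.
  move=> /(group_inverse hG)[h [Gh sh hs]]; rewrite /inv; case: xgetP => //.
  by move=> /(_ h); case.
pose T := S `|` inv @` S.
have TG : T `<=` G.
  move=> t [/SG//|[s /SG Gs <-]]; have [a b] := invP s Gs.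
  exact: (Ginv s).
have Tinv t : T t -> exists2 t', T t' & cancel t t' /\ cancel t' t.
  move=> [St|[s Ss <-]]; first by exists (inv t); [right; exists t|exact/invP/SG].
  by have [a b] := invP s (SG _ Ss); exists s => //; left.
pose W := fix W n := if n is m.+1 then
  (fun uv : (circle R -> circle R) * (circle R -> circle R) => uv.1 \o uv.2) @` (T `*` W m)
  else [set (idfun : circle R -> circle R)].
have Wcomp m n u v : W m u -> W n v -> W (m + n)%N (u \o v).
  elim: m u => [|m IH] u; first by move=> -> Wv; rewrite add0n.
  move=> [[t w] [/= Tt Ww] <-] Wv.
  by exists (t, w \o v) => //; split => //; exact: IH.
have W1 t : T t -> W 1%N t.
  by move=> Tt; exists (t, idfun).
have WG n u : W n u -> G u.
  elim: n u => [|n IH] u; first by move=> ->.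
  by move=> [[t w] [/= /TG Gt /IH Gw] <-]; exact: Gcomp.
have Winv n u : W n u -> exists2 v, W n v & cancel u v /\ cancel v u.
  elim: n u => [|n IH] u; first by move=> ->; exists idfun.
  move=> [[t w] [/= /Tinv[t' Tt' [a b]] /IH[v Wv [c d]]] <-].
  exists (v \o t'); first by have := Wcomp n 1%N v t' Wv (W1 _ Tt'); rewrite addn1.
  by split; [exact: can_comp|exact: can_comp].
have Wcount n : countable (W n).
  elim: n => [|n IH]; first exact: countable1.
  apply: sub_countable (card_image_le _ _) _; apply: countableX => //.
  rewrite /T; have cS : countable S by exact: finite_set_countable.
  rewrite -bigcup2E; apply: bigcup_countable => // -[|[|i]] _ //=.
  exact: sub_countable (card_image_le _ _) cS.
have : countable (\bigcup_n W n) by apply: bigcup_countable.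
apply: sub_countable; apply: subset_card_le; rewrite GE; apply: smallest_sub.
  split.
  - by move=> u [n _ /WG/GD].
  - by exists 0%N.
  - by move=> u v [m _ Wu] [n _ Wv]; exists (m + n)%N => //; exact: Wcomp.
  - move=> u v [n _ Wu] uv vu; exists n => //.
    have [w Ww [uw wu]] := Winv n u Wu.
    suff -> : v = w by [].
    by apply/funext => x; rewrite -{1}(wu x) uv.
by move=> s Ss; exists 1%N => //; apply: W1; left.
Qed.

(** * Uniform expansion away from the points of [NE] *)

Section OneSided.
Context {R : realType}.
Implicit Types (F H : R -> R) (y d t : R).

(** Conjugation by [-%R] exchanges the two sides of a fixed point. *)
Definition reflect_map F t := - F (- t).

Lemma reflectK F : reflect_map (reflect_map F) = F.
Proof. by apply/funext => t; rewrite /reflect_map !opprK. Qed.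

Lemma iter_reflect F k : iter k (reflect_map F) = reflect_map (iter k F).
Proof.
apply/funext => t; rewrite /reflect_map; elim: k => [|k IH] /=; first by rewrite opprK.
by rewrite IH opprK.
Qed.

Lemma is_derive_reflect F t : pos_derivable F ->
  is_derive t 1 (reflect_map F) (derive1 F (- t)).
Proof.
move=> dF; have dFt : is_derive (- t) 1 F (derive1 F (- t)).
  by rewrite derive1E; apply: DeriveDef => //; have [] := dF (- t).
have dN : is_derive t 1 (-%R : R -> R) (-1) by exact: is_deriveNid.
have := @is_derive1_comp R F (-%R) t (derive1 F (- t)) (-1) dFt dN.
move=> /is_deriveN; rewrite mulrN1 opprK.
by have -> : - (F \o -%R) = reflect_map F by exact/funext.
Qed.

Lemma derive1_reflect F t : pos_derivable F ->
  derive1 (reflect_map F) t = derive1 F (- t).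
Proof. by move=> dF; rewrite derive1E; have [_ ->] := is_derive_reflect t dF. Qed.

Lemma pos_derivable_reflect F : pos_derivable F -> pos_derivable (reflect_map F).
Proof.
move=> dF t; have rF := is_derive_reflect t dF.
split; first exact: ex_derive.
by rewrite derive1_reflect//; have [] := dF (- t).
Qed.

Lemma log_lipschitz_reflect K a b F : pos_derivable F -> log_lipschitz K a b F ->
  log_lipschitz K (- b) (- a) (reflect_map F).
Proof.
move=> dF lF s t sI tI; rewrite !(derive1_reflect _ dF).
have -> : `|s - t| = `|- s - - t| by rewrite -opprD normrN.
by apply: lF; move: sI tI; rewrite !in_itv/=; lra.
Qed.

(** By the intermediate value theorem [F - id] has constant sign next to an
    isolated fixed point, and passing to the inverse changes this sign. *)
Lemma one_sided_contraction F H y d : pos_derivable F -> pos_derivable H ->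
  cancel F H -> cancel H F -> F y = y -> 0 < d ->
  (forall t, y < t -> t < y + d -> F t <> t) ->
  exists F', [/\ F' = F \/ F' = H, F' y = y &
    forall t, y < t -> t <= y + d / 2 -> F' t < t].
Proof.
move=> dF dH FK HK Fy d0 nofix; pose b := y + d / 2.
have cD : continuous (fun t => F t - t).
  by move=> t; apply: cvgB; [exact: pos_derivable_continuous|exact: cvg_id].
have noz s t : y < s -> s <= t -> t <= b ->
    ~ (Num.min (F s - s) (F t - t) <= 0 <= Num.max (F s - s) (F t - t)).
  move=> ys st tb /(@IVT R (fun t => F t - t) s t 0 st (continuous_subspaceT cD)).
  move=> [c]; rewrite in_itv/= => /andP[c1 c2] /eqP; rewrite subr_eq0 => /eqP.
  by apply: nofix; rewrite /b in tb; lra.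
have [Fb|bF] := ltP (F b) b.
  exists F; split => //; first by left.
  move=> t yt tb; rewrite ltNge; apply/negP => tF; apply: (@noz t b) => //.
  by case: (leP (F t - t) (F b - b)) => h; lra.
exists H; split; [by right|by rewrite -{1}Fy FK|].
move=> t yt tb; rewrite -(pos_derivable_lt dF) HK ltNge; apply/negP => Ft.
apply: (@noz t b) => //.
by case: (leP (F t - t) (F b - b)) => h; lra.
Qed.

Lemma isolated_fixed_point_escape F H y d : pos_derivable F -> pos_derivable H ->
  cancel F H -> cancel H F ->
  (forall a b, exists2 K, 0 <= K & log_lipschitz K a b F) ->
  (forall a b, exists2 K, 0 <= K & log_lipschitz K a b H) ->
  F y = y -> 0 < d -> (forall t, y < t -> t < y + d -> F t <> t) ->
  exists F' K c e, [/\ F' = F \/ F' = H, 0 <= K, 0 < c, 0 < e &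
    forall t, y < t -> t < y + e -> exists k u, [/\ iter k F' u = t,
      log_lipschitz K (u - c) (u + c) (iter k F') &
      derive1 (iter k F') u <= 1 / 2]].
Proof.
move=> dF dH FK HK lF lH Fy d0 nofix.
have [F' [F'E F'y F'l]] := one_sided_contraction dF dH FK HK Fy d0 nofix.
have dF' : pos_derivable F' by case: F'E => ->.
have [M M0 lM] : exists2 M, 0 <= M & log_lipschitz M y (y + d / 2) F'.
  by case: F'E => ->.
have yb : y < y + d / 2 by rewrite ltrDl divr_gt0.
have [K [c [K0 c0 hq]]] := parabolic_escape dF' F'y yb F'l M0 lM.
have [|e e0 he] := hq (1 / 2); first by lra.
by exists F', K, c, e.
Qed.

End OneSided.

Section LocalExpansion.
Context {R : realType} (G : set (circle R -> circle R)) (hG : subgroup_Diff2_plus G).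
Local Notation proj := (@circle_proj R).
Implicit Types (F H : R -> R) (g h : circle R -> circle R) (e s t u : R).

(** The inverse, near [u], of an element of the group expanding at [t]. Inverses
    are recorded rather than the expanding maps because, being contractions, they
    can be composed on a neighbourhood of fixed size [c]. *)
Definition inverse_branch c K q t F u := [/\ group_lift G F, F u = t,
  derive1 F u <= q & log_lipschitz K (u - c) (u + c) F].

(** One number [e] controls all the constants, so that the property weakens as
    [e] decreases and can be made uniform by compactness. *)
Definition locally_expanded e t :=
  exists F u, inverse_branch e e^-1 (1 - e) t F u.

Lemma locally_expanded_weaken c K q e t F u : inverse_branch c K q t F u ->
  0 < e -> e <= c -> e * K <= 1 -> q <= 1 - e -> locally_expanded e t.
Proof.
move=> [lF Fu qF KF] e0 ec eK qe; exists F, u; split => //; first exact: le_trans qe.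
move=> s v sI vI; apply: le_trans (KF s v _ _) _.
- by move: sI; rewrite !in_itv/=; lra.
- by move: vI; rewrite !in_itv/=; lra.
by apply: ler_wpM2r => //; rewrite -[e^-1]mul1r ler_pdivlMr// mulrC.
Qed.

Lemma locally_expanded_le e e' t : 0 < e' -> e' <= e ->
  locally_expanded e t -> locally_expanded e' t.
Proof.
move=> e'0 ee [F [u B]]; apply: (locally_expanded_weaken B) => //; last by lra.
by rewrite ler_pdivrMr ?mul1r//; lra.
Qed.

Lemma common_scale_ex (c K q : R) : 0 < c -> 0 <= K -> q < 1 ->
  exists e, [/\ 0 < e, e <= c, e * K <= 1 & q <= 1 - e].
Proof.
move=> c0 K0 q1; pose e := Num.min c (Num.min (K + 1)^-1 (1 - q)).
have ec : e <= c by rewrite ge_min lexx.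
have eK : e <= (K + 1)^-1 by rewrite !ge_min lexx orbT.
have eq : e <= 1 - q by rewrite !ge_min lexx !orbT.
have K1 : 0 < K + 1 by lra.
have e0 : 0 < e by rewrite !lt_min c0 invr_gt0 K1 /=; lra.
exists e; split => //; last by lra.
apply: (@le_trans _ _ (e * (K + 1))); first by apply: ler_wpM2l; lra.
by rewrite -ler_pdivlMr// mul1r.
Qed.

Lemma NE_lift t : NE G (proj t) <-> forall F, group_lift G F -> derive1 F t <= 1.
Proof.
split=> [NEt F [g Gg [lF _]]|N g Gg].
  by rewrite -(circle_deriveE t lF); exact: NEt.
have [F lF [lgF _]] := group_lift_ex hG Gg.
by rewrite (circle_deriveE t lgF); exact: N.
Qed.

Lemma locally_expanded_not_NE e t : 0 < e -> locally_expanded e t ->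
  ~ NE G (proj t).
Proof.
move=> e0 [F [u [lF Fu qF _]]] /NE_lift N.
have [H [lH FK HK]] := group_lift_inverse hG lF.
have := N _ lH; rewrite -Fu (group_lift_derive1_inverse hG _ lF lH FK).
have [_ F0] := group_lift_pos_derivable hG lF u.
by rewrite invf_le1//; lra.
Qed.

Lemma not_NE_locally_expanded t : ~ NE G (proj t) -> exists2 e, 0 < e &
  forall s, `|t - s| < e -> locally_expanded e s.
Proof.
move=> /NE_lift/existsNP[F /not_implyP[lF /negP]]; rewrite -ltNge => F1.
have [H [lH FK HK]] := group_lift_inverse hG lF.
have [_ Ft] := group_lift_pos_derivable hG lF t.
pose lam := (1 + derive1 F t) / 2.
have lam1 : 1 < lam by rewrite /lam; lra.
have lamF : 0 < derive1 F t - lam by rewrite /lam; lra.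
have /cvgrPdist_lt/(_ _ lamF)/nbhs_ballP[d1 /= d10 dB1] : derive1 F @ t --> derive1 F t.
  exact: (group_lift_derive1_continuous hG lF).
have /cvgrPdist_lt/(_ _ ltr01)/nbhs_ballP[d2 /= d20 dB2] : F @ t --> F t.
  exact: (group_lift_continuous lF).
have [K K0 lK] := group_lift_log_lipschitz hG (F t - 2) (F t + 2) lH.
have [|e [e0 e1 eK eq]] := @common_scale_ex 1 K lam^-1 ltr01 K0; first by rewrite invf_lt1//; lra.
exists (Num.min e (Num.min d1 d2)); first by rewrite !lt_min e0 d10 d20.
move=> s; rewrite !lt_min => /and3P[se sd1 sd2].
apply: (@locally_expanded_le e); [by rewrite !lt_min e0 d10 d20|by rewrite ge_min lexx|].
have F1s : `|F t - F s| < 1 by exact: dB2.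
have F2s : `|derive1 F t - derive1 F s| < derive1 F t - lam by exact: dB1.
apply: (@locally_expanded_weaken 1 K lam^-1 e s H (F s)) => //; split => //.
  rewrite (group_lift_derive1_inverse hG _ lF lH FK).
  have := ler_norm (derive1 F t - derive1 F s) => Fts.
  by rewrite lef_pV2 ?posrE; lra.
move: F1s; rewrite ltr_norml => /andP[a1 a2].
by move=> p v; rewrite !in_itv/= => pI vI; apply: lK; rewrite in_itv/=; lra.
Qed.

Lemma fixing_lift g t : G g -> g (proj t) = proj t -> exists2 F, monotone_lift g F & F t = t.
Proof.
move=> Gg gt; have [F _ lF] := group_lift_ex hG Gg.
have [[_ pF] _] := lF.
have /esym/proj_eqP[n E] : proj (F t) = proj t by rewrite pF.
by exists (fun s => F s + n%:~R); first exact: monotone_lift_addz.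
Qed.

Lemma right_escape g y : G g -> g (proj y) = proj y ->
  isolated_right (fixed_points g) (proj y) ->
  exists2 e, 0 < e & forall s, y < s -> s < y + e -> locally_expanded e s.
Proof.
move=> Gg gy [d /= d0 dB]; have [F lF Fy] := fixing_lift Gg gy.
have lgF : group_lift G F by exists g.
have [H [lH FK HK]] := group_lift_inverse hG lgF.
have nofix t : y < t -> t < y + d -> F t <> t.
  move=> yt td Ft; have [[_ pF] _] := lF.
  apply: (dB (t - y)); rewrite /= ?subr_gt0//.
    by rewrite sub0r normrN gtr0_norm ?subr_gt0//; lra.
  by rewrite /fixed_points /= -circle_projD addrC subrK -pF Ft.
have [F' [K [c [e [F'E K0 c0 e0 he]]]]] := isolated_fixed_point_escape
  (group_lift_pos_derivable hG lgF) (group_lift_pos_derivable hG lH) FK HK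
  (fun a b => group_lift_log_lipschitz hG a b lgF)
  (fun a b => group_lift_log_lipschitz hG a b lH) Fy d0 nofix.
have lF' : group_lift G F' by case: F'E => ->.
have ce0 : 0 < Num.min c e by rewrite lt_min c0.
have half1 : 1 / 2 < 1 :> R by lra.
have [e' [e'0 e'c e'K e'q]] := common_scale_ex ce0 K0 half1.
move: e'c; rewrite le_min => /andP[e'c e'e].
exists e' => // s ys se; have [|k [u [E lk dk]]] := he s ys; first by lra.
apply: (@locally_expanded_weaken c K (1 / 2) e' s (iter k F') u) => //.
by split => //; exact: group_lift_iter.
Qed.

Lemma left_escape g y : G g -> g (proj y) = proj y ->
  isolated_left (fixed_points g) (proj y) ->
  exists2 e, 0 < e & forall s, y - e < s -> s < y -> locally_expanded e s.
Proof.
move=> Gg gy [d /= d0 dB]; have [F lF Fy] := fixing_lift Gg gy.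
have lgF : group_lift G F by exists g.
have [H [lH FK HK]] := group_lift_inverse hG lgF.
have nofix t : - y < t -> t < - y + d -> reflect_map F t <> t.
  rewrite /reflect_map => yt td Ft; have [[_ pF] _] := lF.
  apply: (dB (t + y)); rewrite /=; [|by lra|].
    by rewrite sub0r normrN gtr0_norm; lra.
  rewrite /fixed_points /= -circle_projB -pF; congr circle_proj.
  have -> : y - (t + y) = - t by ring.
  by rewrite -[in RHS]Ft opprK.
have rcan (A B : R -> R) : cancel A B -> cancel (reflect_map A) (reflect_map B).
  by move=> AB t; rewrite /reflect_map opprK AB opprK.
have rlip A : group_lift G A -> forall a b, exists2 K, 0 <= K & log_lipschitz K a b (reflect_map A).
  move=> lA a b; have [K K0 lK] := group_lift_log_lipschitz hG (- b) (- a) lA.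
  exists K => //; rewrite -(opprK a) -(opprK b).
  by apply: log_lipschitz_reflect => //; exact: (group_lift_pos_derivable hG lA).
have Fy' : reflect_map F (- y) = - y by rewrite /reflect_map opprK Fy.
have [F' [K [c [e [F'E K0 c0 e0 he]]]]] := isolated_fixed_point_escape
  (pos_derivable_reflect (group_lift_pos_derivable hG lgF))
  (pos_derivable_reflect (group_lift_pos_derivable hG lH))
  (rcan _ _ FK) (rcan _ _ HK) (rlip _ lgF) (rlip _ lH) Fy' d0 nofix.
have lF' : group_lift G (reflect_map F') by case: F'E => ->; rewrite reflectK.
have ce0 : 0 < Num.min c e by rewrite lt_min c0.
have half1 : 1 / 2 < 1 :> R by lra.
have [e' [e'0 e'c e'K e'q]] := common_scale_ex ce0 K0 half1.
move: e'c; rewrite le_min => /andP[e'c e'e].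
exists e' => // s es sy; have [||k [u [E lk dk]]] := he (- s); [by lra|by lra|].
have lfk := group_lift_iter hG k lF'.
have pfk := group_lift_pos_derivable hG lfk.
have rk : iter k F' = reflect_map (iter k (reflect_map F')) by rewrite iter_reflect reflectK.
apply: (@locally_expanded_weaken c K (1 / 2) e' s (iter k (reflect_map F')) (- u)) => //.
split => //.
- by move: E; rewrite rk /reflect_map => /oppr_inj.
- by rewrite -(derive1_reflect _ pfk) -rk.
- rewrite iter_reflect.
  have -> : - u - c = - (u + c) by ring.
  have -> : - u + c = - (u - c) by ring.
  by apply: log_lipschitz_reflect => //; rewrite rk; exact: pos_derivable_reflect.
Qed.

Lemma locally_expanded_addz e t (n : int) : locally_expanded e t ->
  locally_expanded e (t + n%:~R).
Proof.
move=> [F [u [lF Fu qF KF]]].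
have dF s : derive1 (fun t => F t + n%:~R) s = derive1 F s.
  by rewrite derive1_add_cst// => v; have [] := group_lift_pos_derivable hG lF v.
exists (fun t => F t + n%:~R), u; split.
- exact: group_lift_addz.
- by rewrite Fu.
- by rewrite dF.
by move=> s v sI vI; rewrite !dF; exact: KF.
Qed.

Variable L : set (circle R).
Hypothesis cL : closed L.
Hypothesis hstar : property_Lambda_star G L.

(** Near a point of [NE] the elements given by property (Lambda star) expand on
    both sides; elsewhere some derivative is larger than one, and remains so
    nearby. *)
Lemma local_dichotomy y : L (proj y) -> exists2 e, 0 < e &
  forall s, `|y - s| < e -> (s = y /\ NE G (proj y)) \/ locally_expanded e s.
Proof.
move=> Ly; have [NEy|nNEy] := pselect (NE G (proj y)); last first.
  have [e e0 he] := not_NE_locally_expanded nNEy.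
  by exists e => // s /he; right.
have [gp [gm [[Gp Gm px mx] [ir il]]]] := hstar.2 _ (conj NEy Ly).
have [e1 e10 he1] := right_escape Gp px ir.
have [e2 e20 he2] := left_escape Gm mx il.
exists (Num.min e1 e2); first by rewrite lt_min e10.
move=> s; rewrite lt_min => /andP[s1 s2].
have m0 : 0 < Num.min e1 e2 by rewrite lt_min e10.
case: (ltgtP s y) => sy; [right|right|by left].
  apply: (@locally_expanded_le e2) => //; first by rewrite ge_min lexx orbT.
  by apply: he2 => //; move: s2; rewrite ltr_norml => /andP[]; lra.
apply: (@locally_expanded_le e1) => //; first by rewrite ge_min lexx.
by apply: he1 => //; move: s1; rewrite ltr_norml => /andP[]; lra.
Qed.

Lemma uniform_local_expansion : exists2 e, 0 < e &
  forall t, L (proj t) -> ~ NE G (proj t) -> locally_expanded e t.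
Proof.
apply: (@closed_uniform_scale _ L (fun e s => ~ NE G (proj s) -> locally_expanded e s) cL).
- by move=> e e' s e'0 ee he NEs; apply: locally_expanded_le (he NEs).
- move=> e s n he NEs; rewrite -(addrK n%:~R s) -intrN; apply: locally_expanded_addz.
  by apply: he; rewrite proj_addz.
- move=> y Ly; have [e e0 he] := local_dichotomy Ly; exists e => // s ys NEs.
  by have [[E NEy]|//] := he s ys; exfalso; apply: NEs; rewrite E.
Qed.

(** Points of [NE] in the minimal set are isolated from each other because their
    neighbours are expanded. *)
Lemma NE_countable : countable (NE G `&` L).
Proof.
have [e e0 he] : exists2 e, 0 < e & forall s, L (proj s) ->
    forall t, NE G (proj s) -> NE G (proj t) -> `|s - t| < e -> s = t.
  apply: (@closed_uniform_scale _ L (fun e s => forall t, _) cL).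
  - by move=> e e' s e'0 ee he t NEs NEt st; apply: he => //; exact: lt_le_trans st ee.
  - move=> e s n he t NEs NEt st; apply: (addIr n%:~R); apply: he; rewrite ?proj_addz//.
    by rewrite opprD addrACA subrr addr0.
  - move=> y Ly; have [e e0 he] := local_dichotomy Ly.
    have NEe s : `|y - s| < e -> NE G (proj s) -> s = y.
      by move=> /he[[]//|/(locally_expanded_not_NE e0)].
    exists (e / 2); first by rewrite divr_gt0.
    move=> s ys t NEs NEt st.
    have -> : s = y by apply: NEe NEs; apply: lt_trans ys _; lra.
    apply/esym/NEe => //; have -> : y - t = (y - s) + (s - t) by ring.
    by apply: le_lt_trans (ler_normD _ _) _; lra.
have cA : countable (proj @^-1` (NE G `&` L)).
  have /countable_injP[f finj] : countable [set: int] by exact: countableP.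
  apply/countable_injP; exists (fun t => f (Num.floor (t / e))) => s t.
  rewrite !inE => -[NEs Ls] [NEt Lt] /finj; rewrite !inE => /(_ I I) E.
  apply: he => //.
  have := floor_le (s / e); have := floorD1_gt (s / e).
  have := floor_le (t / e); have := floorD1_gt (t / e).
  rewrite E intrD => a1 a2 a3 a4.
  have : `|s / e - t / e| < 1 by rewrite ltr_norml; apply/andP; split; lra.
  by rewrite -mulrBl normrM [`|e^-1|]gtr0_norm ?invr_gt0// ltr_pdivrMr// mul1r.
apply: sub_countable (subset_card_le _) (sub_countable (card_image_le proj _) cA).
by move=> x NLx; have [t _ E] := proj_surj x 0; exists t; rewrite /preimage /= E.
Qed.

End LocalExpansion.

(** * Conical points *)

Section Conical.
Context {R : realType} (G : set (circle R -> circle R)) (hG : subgroup_Diff2_plus G).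
Local Notation proj := (@circle_proj R).
Implicit Types (F H : R -> R) (g h : circle R -> circle R) (e s t u : R).
Variable L : set (circle R).
Hypothesis cL : closed L.
Hypothesis iL : invariant_set G L.
Hypothesis hstar : property_Lambda_star G L.

(** The orbit of [NE] is excluded because the successive expansions of a point
    stop once it is carried into [NE]. *)
Definition conical := L `\` \bigcup_(g in G) (g @` (NE G `&` L)).

Lemma conical_lift F t : group_lift G F -> conical (proj (F t)) -> conical (proj t).
Proof.
have [_ _ Gcomp _] := hG.
move=> lF [LFt N]; split; first by rewrite -(group_lift_invariant hG _ iL lF).
move=> [g Gg [x NLx gx]]; apply: N; have [f Gf [[_ pF] _]] := lF.
by exists (f \o g); [exact: Gcomp|exists x => //=; rewrite gx pF].
Qed.

Lemma conical_not_NE t : conical (proj t) -> ~ NE G (proj t).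
Proof.
have [_ G1 _ _] := hG.
by move=> [Lt N] NEt; apply: N; exists idfun => //; exists (proj t).
Qed.

Lemma log_lipschitz_derive1_le F K c u s : pos_derivable F ->
  log_lipschitz K (u - c) (u + c) F -> 0 <= K -> `|s - u| <= c ->
  derive1 F s <= expR (K * c) * derive1 F u /\
  derive1 F u <= expR (K * c) * derive1 F s.
Proof.
move=> dF lF K0 su; have c0 : 0 <= c by exact: le_trans su.
have sI : s \in `[u - c, u + c] by move: su; rewrite ler_norml in_itv/=; lra.
have uI : u \in `[u - c, u + c] by rewrite in_itv/=; lra.
have [_ Fs] := dF s; have [_ Fu] := dF u.
have Kc : expR (K * `|s - u|) <= expR (K * c) by rewrite ler_expR ler_wpM2l.
split.
  by apply: le_trans (log_lipschitz_le dF lF sI uI) _; rewrite ler_pM2r.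
apply: le_trans (log_lipschitz_le dF lF uI sI) _.
by rewrite distrC ler_pM2r.
Qed.

(** Composing local expansions repeatedly, the distortions add up to a geometric
    series, because each further step is measured at a scale already contracted
    by the previous ones. *)
Lemma conical_inverse_branches : exists r K, [/\ 0 < r, 0 <= K &
  forall t, conical (proj t) -> forall q, 0 < q ->
  exists F u, inverse_branch G r K q t F u].
Proof.
have [e0 e00 he0] := uniform_local_expansion hG cL hstar.
pose e := Num.min e0 (1 / 2).
have e_0 : 0 < e by rewrite lt_min e00 /=; lra.
have e_2 : e <= 1 / 2 by rewrite ge_min lexx orbT.
have he t : conical (proj t) -> locally_expanded G e t.
  move=> ct; apply: (@locally_expanded_le _ _ e0) => //; first by rewrite ge_min lexx.
  by apply: he0; [case: ct|exact: conical_not_NE].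
(* at the scale [r] distortion worsens the contraction [1 - e] by a factor at
   most [lam], that is to [q'], and [K] is the sum of the geometric series
   [e^-1 * q' ^+ n] *)
pose lam := (1 - e / 2) / (1 - e).
have lam1 : 1 < lam by rewrite /lam ltr_pdivlMr; lra.
pose r := Num.min e (e * ln lam).
have r0 : 0 < r by rewrite lt_min e_0 mulr_gt0// ln_gt0.
have re : r <= e by rewrite ge_min lexx.
have rlam : expR (e^-1 * r) <= lam.
  rewrite -[leRHS]lnK ?posrE; last by lra.
  rewrite ler_expR ler_pdivrMl//; by rewrite ge_min lexx orbT.
pose q' := 1 - e / 2; pose K := e^-1 / (e / 2).
have K0 : 0 <= K by rewrite /K !divr_ge0 ?invr_ge0// ltW// divr_gt0.
have KE : K * q' + e^-1 = K.
  by rewrite /K /q' mulrBr mulr1 divfK ?subrK// gt_eqF// divr_gt0.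
exists r, K; split => //.
have branches t n : conical (proj t) -> exists F u, inverse_branch G r K ((1 - e) ^+ n) t F u.
  move=> ct; elim: n => [|n [F [u [lF Fu qF KF]]]].
    exists id, t; split => //; first exact: group_lift_id.
      by rewrite derive1E derive_id expr0.
    by move=> s v _ _; rewrite !derive1E !derive_id subrr normr0 mulr_ge0.
  have cu : conical (proj u) by apply: (conical_lift lF); rewrite Fu.
  have [H [v [lH Hv qH KH]]] := he u cu.
  have dF := group_lift_pos_derivable hG lF; have dH := group_lift_pos_derivable hG lH.
  exists (F \o H), v; split.
  - exact: group_lift_comp.
  - by rewrite /= Hv.
  - rewrite derive1_pos_comp// exprS mulrC Hv.
    by apply: ler_pM => //; [have [_ /ltW] := dH v|have [_ /ltW] := dF u].
  have KH' : log_lipschitz e^-1 (v - r) (v + r) H.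
    by move=> a b; rewrite !in_itv/= => aI bI; apply: KH; rewrite in_itv/=; lra.
  have ei0 : 0 <= e^-1 by rewrite invr_ge0 ltW.
  have Hq' s : `|s - v| <= r -> derive1 H s <= q'.
    move=> sv; have [h1 _] := log_lipschitz_derive1_le dH KH' ei0 sv.
    apply: le_trans h1 _; have [_ Hv0] := dH v.
    apply: (@le_trans _ _ (lam * (1 - e))).
      by apply: ler_pM => //; exact: ltW.
    by rewrite /lam divfK//; apply/lt0r_neq0; lra.
  have q'0 : 0 <= q' by rewrite /q'; lra.
  have q'1 : q' <= 1 by rewrite /q'; lra.
  rewrite -KE; apply: (log_lipschitz_comp dF dH KF KH' K0 q'0).
  move=> s; rewrite in_itv/= => /andP[s1 s2].
  have sv : `|s - v| <= r by rewrite ler_norml; clear - s1 s2; apply/andP; split; lra.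
  split; last exact: Hq'.
  rewrite in_itv/= -Hv.
  have key a b : a <= b -> v - r <= a -> b <= v + r -> H b - H a <= b - a /\ 0 <= H b - H a.
    move=> ab va bv; have [c cI ->] := pos_derivable_mvt dH ab.
    have [_ Hc0] := dH c.
    have Hc : derive1 H c <= 1.
      apply: le_trans (Hq' c _) q'1; move: cI; rewrite in_itv/= => /andP[c1 c2].
      by rewrite ler_norml; apply/andP; split; lra.
    by split; [rewrite ler_piMl// subr_ge0|rewrite mulr_ge0 ?subr_ge0// ltW].
  have [vs|/ltW sv'] := leP v s.
    have [||k1 k2] := key v s vs; [by clear - r0; lra|exact: s2|].
    by clear - k1 k2 s1 s2 r0; lra.
  have [||k1 k2] := key s v sv'; [exact: s1|by clear - r0; lra|].
  by clear - k1 k2 s1 s2 r0; lra.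
move=> t ct q q0.
have q1 : `|1 - e| < 1 by rewrite ger0_norm; lra.
have /cvgrPdist_lt/(_ _ q0)[N _ /(_ N (leqnn _))] := @cvg_expr _ _ q1.
rewrite sub0r normrN normrX ger0_norm; last by lra.
move=> /= qN; have [F [u [lF Fu qF KF]]] := branches t N ct.
by exists F, u; split => //; exact: le_trans qF (ltW qN).
Qed.

(** The radius is shrunk until the distortion is at most two. *)
Lemma conical_zoom : exists2 r, 0 < r &
  forall t, conical (proj t) -> forall q, 0 < q -> exists F u tau,
  [/\ group_lift G F, F u = t, 0 < tau <= q &
    forall s, `|s - u| <= r -> tau / 2 <= derive1 F s <= 2 * tau].
Proof.
have [r [K [r0 K0 hr]]] := conical_inverse_branches.
have ln20 : 0 < ln (2 : R) by rewrite ln_gt0//; lra.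
pose c := Num.min r (ln 2 / (K + 1)).
have K1 : 0 < K + 1 by lra.
have c0 : 0 < c by rewrite lt_min r0 divr_gt0.
have cr : c <= r by rewrite ge_min lexx.
have Kc : expR (K * c) <= 2.
  rewrite -[leRHS]lnK ?posrE//.
  rewrite ler_expR; apply: (@le_trans _ _ ((K + 1) * (ln 2 / (K + 1)))).
    apply: ler_pM => //; [exact: ltW|by lra|by rewrite ge_min lexx orbT].
  by rewrite mulrC divfK// gt_eqF.
exists c => // t ct q q0; have [F [u [lF Fu qF KF]]] := hr t ct q q0.
have dF := group_lift_pos_derivable hG lF; have [_ Fu0] := dF u.
exists F, u, (derive1 F u); split => //; first by rewrite Fu0.
move=> s su.
have KF' : log_lipschitz K (u - c) (u + c) F.
  by move=> a b; rewrite !in_itv/= => aI bI; apply: KF; rewrite in_itv/=; lra.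
have [h1 h2] := log_lipschitz_derive1_le dF KF' K0 su.
have [_ Fs0] := dF s.
have h3 : expR (K * c) * derive1 F s <= 2 * derive1 F s by rewrite ler_pM2r.
have h4 : expR (K * c) * derive1 F u <= 2 * derive1 F u by rewrite ler_pM2r.
by apply/andP; split; lra.
Qed.

Lemma nonconical_countable : finitely_generated G -> countable (L `\` conical).
Proof.
move=> fg; have cG := finitely_generated_countable hG fg.
apply: (@sub_countable _ _ _ (\bigcup_(g in G) (g @` (NE G `&` L)))).
  apply: subset_card_le => x [Lx nc]; apply: contrapT => N.
  by apply: nc; split.
apply: bigcup_countable => // g Gg.
exact: sub_countable (card_image_le _ _) (NE_countable hG cL hstar).
Qed.

End Conical.

(** * Conformal measures of arcs *)

Section Conformal.
Context {R : realType} (G : set (circle R -> circle R)) (hG : subgroup_Diff2_plus G).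
Local Notation proj := (@circle_proj R).
Implicit Types (F H : R -> R) (g h : circle R -> circle R) (a b e s t u tau : R).
Variables (delta : R) (nu : probability (borel_circle R) R).
Hypothesis nuG : conformal_measure G delta nu.

Definition circle_arc a b : set (borel_circle R) := proj @` `[a, b].

Lemma measurable_closed_circle (A : set (borel_circle R)) :
  closed (A : set (circle R)) -> measurable A.
Proof.
move=> cA; rewrite -[A]setCK; apply: measurableC; apply: sub_sigma_algebra.
exact: closed_openC.
Qed.

Lemma measurable_circle_arc a b : measurable (circle_arc a b).
Proof. by apply: measurable_closed_circle; exact: proj_itv_closed. Qed.

Lemma circle_arcS a b a' b' : a' <= a -> b <= b' -> circle_arc a b `<=` circle_arc a' b'.
Proof.
move=> aa bb x [t]; rewrite /= in_itv/= => /andP[t1 t2] <-; exists t => //=.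
by rewrite in_itv/=; lra.
Qed.

Lemma circle_derive_measurable g : G g ->
  measurable_fun [set: borel_circle R] (circle_derive g : borel_circle R -> R).
Proof.
move=> Gg; have [F lgF [lF _]] := group_lift_ex hG Gg.
move=> mD; apply: (measurability _ (RGenOInfty.measurableE R)) => //.
move=> _ [_ [a ->] <-]; rewrite setTI; apply: sub_sigma_algebra.
rewrite openE => x /=; have [t _ <-] := proj_surj x 0.
rewrite in_itv/= andbT (circle_deriveE t lF) => aF.
have eps0 : 0 < derive1 F t - a by rewrite subr_gt0.
have /cvgrPdist_lt/(_ _ eps0)/nbhs_ballP[d /= d0 dB] : derive1 F @ t --> derive1 F t.
  exact: (group_lift_derive1_continuous hG lgF).
apply/metricType_numDomainType.nbhs_mdistP; exists d => //= y.
move=> /mdist_proj_lift[s st <-] /=; rewrite in_itv/= andbT (circle_deriveE s lF).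
by have := le_lt_trans (ler_norm _) (dB s st); lra.
Qed.

Lemma image_circle_arc F g a b : monotone_lift g F -> group_lift G F ->
  g @` (circle_arc a b) = circle_arc (F a) (F b).
Proof.
move=> [[_ pF] _] lF; have dF := group_lift_pos_derivable hG lF.
have [H [lH FK HK]] := group_lift_inverse hG lF.
apply/seteqP; split.
  move=> _ [_ [t tI <-] <-]; exists (F t); last by rewrite pF.
  by move: tI; rewrite /= !in_itv/= !(pos_derivable_le dF).
move=> _ [v vI <-]; exists (proj (H v)); last by rewrite -pF HK.
exists (H v) => //; move: vI.
by rewrite /= !in_itv/= -(pos_derivable_le dF a (H v)) -(pos_derivable_le dF (H v) b) HK.
Qed.

Lemma conformal_circle_arc_lower F a b m : group_lift G F -> 0 <= m ->
  (forall s, s \in `[a, b] -> m <= derive1 F s `^ delta) ->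
  (m%:E * nu (circle_arc a b) <= nu (circle_arc (F a) (F b)))%E.
Proof.
move=> lF m0 hm; have [g Gg mF] := lF.
rewrite -(image_circle_arc a b mF lF) (nuG Gg (measurable_circle_arc a b)).
rewrite -(integral_cst nu (measurable_circle_arc a b)).
apply: ge0_le_integral => //=.
- exact: measurable_circle_arc.
- apply/measurable_EFinP; apply: measurable_funTS.
  apply: (measurableT_comp (measurable_powR _)) => //.
  apply: (measurableT_comp (@normr_measurable _ setT)).
  exact: circle_derive_measurable.
- move=> _ [s sI <-]; rewrite lee_fin (circle_deriveE s mF.1).
  by rewrite gtr0_norm; [exact: hm|have [] := group_lift_pos_derivable hG lF s].
Qed.

(** The absolute value makes room for a negative exponent, not yet excluded. *)
Lemma powR_distortion (D tau z d : R) : 1 <= D -> 0 < tau ->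
  tau / D <= z -> z <= D * tau ->
  tau `^ d / D `^ `|d| <= z `^ d /\ z `^ d <= D `^ `|d| * tau `^ d.
Proof.
move=> D1 tau0 tz zt.
have D0 : 0 < D by lra.
have z0 : 0 < z by apply: lt_le_trans tz; rewrite divr_gt0.
have lz : `|ln z - ln tau| <= ln D.
  rewrite ler_norml; apply/andP; split.
    by have := tz; rewrite -ler_ln ?posrE ?divr_gt0// ln_div ?posrE//; lra.
  by have := zt; rewrite -ler_ln ?posrE ?mulr_gt0// lnM ?posrE//; lra.
rewrite /powR !gt_eqF// -expRN -!expRD !ler_expR.
have : `|d * (ln z - ln tau)| <= `|d| * ln D by rewrite normrM ler_wpM2l.
by rewrite ler_norml mulrBr => /andP[h1 h2]; split; lra.
Qed.

(** The upper bound for [F] is the lower bound for its inverse. *)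
Lemma conformal_circle_arc F a b D tau : group_lift G F -> 1 <= D -> 0 < tau ->
  (forall s, s \in `[a, b] -> tau / D <= derive1 F s <= D * tau) ->
  ((tau `^ delta / D `^ `|delta|)%:E * nu (circle_arc a b) <= nu (circle_arc (F a) (F b)))%E /\
  (nu (circle_arc (F a) (F b)) <= (D `^ `|delta| * tau `^ delta)%:E * nu (circle_arc a b))%E.
Proof.
move=> lF D1 tau0 hF; have D0 : 0 < D by lra.
have P0 : 0 < D `^ `|delta| by rewrite powR_gt0.
have T0 : 0 < tau `^ delta by rewrite powR_gt0.
split.
  apply: conformal_circle_arc_lower => //; first by rewrite divr_ge0// ltW.
  by move=> s /hF/andP[h1 h2]; have [] := powR_distortion delta D1 tau0 h1 h2.
have [H [lH FK HK]] := group_lift_inverse hG lF.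
have dF := group_lift_pos_derivable hG lF.
have ti0 : 0 < tau^-1 by rewrite invr_gt0.
have low : (((tau^-1) `^ delta / D `^ `|delta|)%:E * nu (circle_arc (F a) (F b)) <=
    nu (circle_arc (H (F a)) (H (F b))))%E.
  apply: conformal_circle_arc_lower => //; first by rewrite divr_ge0 ?powR_ge0.
  move=> v; rewrite in_itv/= => vI.
  have := hF (H v); rewrite in_itv/= -(pos_derivable_le dF a (H v)) -(pos_derivable_le dF (H v) b) HK.
  move=> /(_ vI)/andP[h1 h2].
  have -> : derive1 H v = (derive1 F (H v))^-1.
    by rewrite -{1}(HK v) (group_lift_derive1_inverse hG _ lF lH FK).
  have [_ F0] := dF (H v).
  have [||//] := @powR_distortion D tau^-1 (derive1 F (H v))^-1 delta D1 ti0.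
    by rewrite -invfM lef_pV2 ?posrE ?mulr_gt0// mulrC.
  by rewrite -[D in leRHS]invrK -invfM lef_pV2 ?posrE ?mulr_gt0 ?invr_gt0// mulrC.
move: low; rewrite !FK.
have -> : (tau^-1) `^ delta = (tau `^ delta)^-1.
  by rewrite -powR_inv1 ?ltW// -powRrM mulN1r powRN.
rewrite -invfM mulrC => h.
by rewrite -lee_pdivrMl ?mulr_gt0// muleC.
Qed.

Variable L : set (circle R).
Hypothesis mL : minimal_set G L.
Hypothesis cG : countable G.
Hypothesis nuL : supported_on nu L.

(** An arc around a point of the minimal set is carried by the countable group
    onto a cover of the minimal set, so it cannot be a null set. *)
Lemma circle_arc_gt0 u e : L (proj u) -> 0 < e -> (0 < nu (circle_arc (u - e) (u + e)))%E.
Proof.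
move=> Lu e0; rewrite lt0e measure_ge0 andbT; apply/eqP => nu0.
have [_ cL iL _] := mL; have [_ G1 _ _] := hG.
have null g : G g -> nu.-negligible (g @` (circle_arc (u - e) (u + e))).
  move=> Gg; have [F lF mF] := group_lift_ex hG Gg.
  rewrite (image_circle_arc _ _ mF lF); exists (circle_arc (F (u - e)) (F (u + e))); split => //.
    exact: measurable_circle_arc.
  have [K K0 lK] := group_lift_log_lipschitz hG (u - e) (u + e) lF.
  have dF := group_lift_pos_derivable hG lF; have [_ Fu0] := dF u.
  have D1 : 1 <= expR (K * e) by rewrite -expR0 ler_expR mulr_ge0// ltW.
  have [|_] := @conformal_circle_arc F (u - e) (u + e) (expR (K * e)) (derive1 F u) lF D1 Fu0.
    move=> s; rewrite in_itv/= => sI.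
    have su : `|s - u| <= e by rewrite ler_norml; lra.
    have [h1 h2] := log_lipschitz_derive1_le dF lK K0 su.
    by rewrite h1 andbT ler_pdivrMr ?expR_gt0// mulrC.
  by rewrite nu0 mule0 => h; apply/eqP; rewrite eq_le h measure_ge0.
have /countable_injP[f finj] := cG.
pose N n := \bigcup_(g in [set g | G g /\ f g = n]) (g @` (circle_arc (u - e) (u + e))).
have nN n : nu.-negligible (N n).
  have [[g [Gg fg]]|no] := pselect (exists g, G g /\ f g = n).
    suff -> : N n = g @` (circle_arc (u - e) (u + e)) by exact: null.
    apply/seteqP; split => [x [g' [Gg' fg'] xg]|x xg]; last by exists g.
    by rewrite (finj g g') ?inE// fg fg'.
  suff -> : N n = set0 by exact: negligible_set0.
  by apply/seteqP; split => // x [g Gfg _]; apply: no; exists g.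
have : nu.-negligible (L : set (borel_circle R)).
  apply: negligibleS (negligible_bigcup nN) => x Lx.
  have [|g Gg] := @minimal_orbit_meets _ G hG L (ball (proj u) e)° x mL (@open_interior _ _) _ Lx.
    by exists (proj u); split => //; exact: nbhsx_ballx.
  move=> /interior_subset; rewrite ballEmdist /= => /mdist_proj_lift[s us Es].
  have [h [Gh gK hK]] := group_inverse hG Gg.
  exists (f h) => //; exists h => //; exists (g x); last by rewrite gK.
  exists s => //=; rewrite in_itv/=; move: us; rewrite ltr_norml; lra.
move=> /negligibleP -/(_ (measurable_closed_circle cL)) L0.
pose L' : set (borel_circle R) := L.
have mL' : measurable L' by exact: measurable_closed_circle.
have E : (nu (~` L') + nu L' = 1)%E.
  rewrite -measureU//; [|exact: measurableC|by rewrite setICl].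
  by rewrite setvU; exact: probability_setT.
have nuL0 : nu (~` L') = 0%E by exact: nuL.
by move: E; rewrite nuL0 [nu L']L0 adde0 => /eqP; rewrite eq_sym onee_eq0.
Qed.

Lemma circle_arc_addz a b (n : int) : circle_arc (a + n%:~R) (b + n%:~R) = circle_arc a b.
Proof.
apply/seteqP; split => x [t]; rewrite /= in_itv/= => tI <-.
  exists (t - n%:~R); first by rewrite /= in_itv/=; lra.
  by apply/proj_eqP; exists (- n); rewrite intrN.
exists (t + n%:~R); first by rewrite /= in_itv/=; lra.
by apply/proj_eqP; exists n.
Qed.

Lemma circle_arc_uniform_gt0 e : 0 < e -> exists2 m, 0 < m &
  forall u, L (proj u) -> (m%:E <= nu (circle_arc (u - e) (u + e)))%E.
Proof.
move=> e0; have [_ cL _ _] := mL.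
apply: (@closed_uniform_scale _ L (fun m u => (m%:E <= nu (circle_arc (u - e) (u + e)))%E) cL).
- by move=> m m' s _ mm; apply: le_trans; rewrite lee_fin.
- by move=> m s n; rewrite addrAC -[s + _ + e]addrAC circle_arc_addz.
- move=> y Ly; have e20 : 0 < e / 2 by rewrite divr_gt0.
  have := circle_arc_gt0 Ly e20; set v := nu _ => v0.
  have fv : v \is a fin_num by apply: fin_num_measure; exact: measurable_circle_arc.
  exists (Num.min (fine v) (e / 2)); first by rewrite lt_min e20 andbT fine_gt0// v0 ltey_eq fv.
  move=> s; rewrite lt_min => /andP[_ ys].
  apply: (@le_trans _ _ v); first by rewrite -[leRHS]fineK// lee_fin ge_min lexx.
  apply: le_measure; rewrite ?inE; [exact: measurable_circle_arc|exact: measurable_circle_arc|].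
  by move: ys; rewrite ltr_norml => ys; apply: circle_arcS; lra.
Qed.

End Conformal.

(** * Scaling of a conformal measure at conical points *)

Section Undistorted.
Context {R : realType}.
Implicit Types (F : R -> R) (a b u r tau w v : R).

Lemma derive1_bounds F a b lo hi : pos_derivable F -> a <= b ->
  (forall c, c \in `[a, b] -> lo <= derive1 F c <= hi) ->
  lo * (b - a) <= F b - F a <= hi * (b - a).
Proof.
move=> dF ab h; have [c cI ->] := pos_derivable_mvt dF ab.
by have /andP[h1 h2] := h c cI; rewrite !ler_wpM2r ?subr_ge0.
Qed.

Lemma undistorted_bounds F u r tau a b : pos_derivable F ->
  (forall s, `|s - u| <= r -> tau / 2 <= derive1 F s <= 2 * tau) ->
  u - r <= a -> a <= b -> b <= u + r ->
  tau / 2 * (b - a) <= F b - F a <= 2 * tau * (b - a).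
Proof.
move=> dF hF ua ab bu; apply: derive1_bounds => // c.
rewrite in_itv/= => /andP[ac cb]; apply: hF.
by rewrite ler_norml; apply/andP; split; lra.
Qed.

Lemma undistorted_ends F u r tau w : pos_derivable F ->
  (forall s, `|s - u| <= r -> tau / 2 <= derive1 F s <= 2 * tau) ->
  0 <= w -> w <= r ->
  [/\ F u - 2 * tau * w <= F (u - w), F (u - w) <= F u - tau / 2 * w,
      F u + tau / 2 * w <= F (u + w) & F (u + w) <= F u + 2 * tau * w].
Proof.
move=> dF hF w0 wr.
have [|||a1 a2] := andP (@undistorted_bounds F u r tau (u - w) u dF hF _ _ _); [by lra..|].
have [|||b1 b2] := andP (@undistorted_bounds F u r tau u (u + w) dF hF _ _ _); [by lra..|].
by split; lra.
Qed.

Lemma undistorted_dist F u r tau w v : pos_derivable F ->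
  (forall s, `|s - u| <= r -> tau / 2 <= derive1 F s <= 2 * tau) ->
  0 <= tau -> `|v - u| <= w -> w <= r -> `|F v - F u| <= 2 * tau * w.
Proof.
move=> dF hF tau0 vw wr; have w0 : 0 <= w by exact: le_trans vw.
have [h1 _ _ h2] := undistorted_ends dF hF w0 wr.
move: vw; rewrite !ler_norml => /andP[v1 v2].
have : F (u - w) <= F v by rewrite (pos_derivable_le dF); lra.
have : F v <= F (u + w) by rewrite (pos_derivable_le dF); lra.
by move=> *; apply/andP; split; lra.
Qed.

End Undistorted.

Section Pieces.
Context {R : realType} (G : set (circle R -> circle R)) (hG : subgroup_Diff2_plus G).
Local Notation proj := (@circle_proj R).
Implicit Types (F H : R -> R) (g h : circle R -> circle R) (a b e p q s t u tau : R).

Variable L : set (circle R).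
Hypothesis mL : minimal_set G L.
Hypothesis hstar : property_Lambda_star G L.

(** Minimality moves [p] close to each point [u], and compactness bounds from
    below the size of the interval moved along and its contraction. *)
Lemma uniform_copies p e : L (proj p) -> 0 < e -> exists2 k, 0 < k &
  forall u, L (proj u) -> exists2 H, group_lift G H &
  forall s, `|p - s| < k -> `|u - H s| < e /\ k <= derive1 H s.
Proof.
move=> Lp e0; have [_ cL iL _] := mL.
apply: (@closed_uniform_scale _ L (fun k u => exists2 H, group_lift G H &
  forall s, `|p - s| < k -> `|u - H s| < e /\ k <= derive1 H s) cL).
- move=> k k' u k'0 kk [H lH hH]; exists H => // s ps.
  have [|h1 h2] := hH s; first exact: lt_le_trans kk.
  by split => //; exact: le_trans h2.
- move=> k u n [H lH hH]; exists (fun s => H s + (- n)%:~R); first exact: group_lift_addz.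
  move=> s /hH; rewrite (derive1_add_cst _ (fun v => (group_lift_pos_derivable hG lH v).1)).
  by rewrite intrN opprD opprK addrA addrAC.
- move=> y Ly; have e30 : 0 < e / 3 by rewrite divr_gt0.
  have [H lH yH] := minimal_lift_dense hG mL Lp Ly e30.
  have /cvgrPdist_lt/(_ _ e30)/nbhs_ballP[d1 /= d10 dB1] : H @ p --> H p.
    exact: (group_lift_continuous lH).
  have [_ Hp] := group_lift_pos_derivable hG lH p.
  have Hp2 : 0 < derive1 H p / 2 by rewrite divr_gt0.
  have /cvgrPdist_lt/(_ _ Hp2)/nbhs_ballP[d2 /= d20 dB2] : derive1 H @ p --> derive1 H p.
    exact: (group_lift_derive1_continuous hG lH).
  pose k := Num.min (e / 3) (Num.min (derive1 H p / 2) (Num.min d1 d2)).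
  have [k1 k2 k3 k4] : [/\ k <= e / 3, k <= derive1 H p / 2, k <= d1 & k <= d2].
    by split; rewrite !ge_min lexx ?orbT.
  exists k; first by rewrite !lt_min e30 Hp2 d10.
  move=> u yu; exists H => // s ps.
  have := dB1 s (lt_le_trans ps k3); have := dB2 s (lt_le_trans ps k4).
  move=> /(le_lt_trans (ler_norm _)) q1 q2; split; last by lra.
  have -> : u - H s = - (y - u) + ((y - H p) + (H p - H s)) by ring.
  apply: le_lt_trans (ler_normD _ _) _; rewrite normrN.
  by have := ler_normD (y - H p) (H p - H s); lra.
Qed.

Variables (delta : R) (nu : probability (borel_circle R) R).
Hypothesis nuG : conformal_measure G delta nu.
Hypothesis cG : countable G.
Hypothesis nuL : supported_on nu L.

(** The constants [m] and [k] are to be uniform; the interval of radius [k]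
    around [p] carries the fixed piece of the minimal set copied at all good
    scales. *)
Definition good_scale (p m k t rho : R) F :=
  [/\ ((m * rho `^ delta)%:E <= nu (circle_arc (t - rho)%R (t + rho)%R))%E,
      (nu (circle_arc (t - 5 * rho)%R (t + 5 * rho)%R) <= (rho `^ delta / m)%:E)%E,
      group_lift G F &
      forall s, `|p - s| < k -> `|F s - t| <= rho /\ k * rho <= derive1 F s].

Lemma conical_good_scales p : L (proj p) -> exists m k, [/\ 0 < m, 0 < k &
  forall t, conical G L (proj t) -> forall e, 0 < e ->
  exists rho F, 0 < rho < e /\ good_scale p m k t rho F].
Proof.
move=> Lp; have [_ cL iL _] := mL.
have [r r0 hr] := conical_zoom hG cL iL hstar.
(* For [rho = tau * r / 20], the ball of radius [rho] contains the image of the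
   [r / 40]-neighbourhood of [u], while the ball of radius [5 * rho] is contained
   in the image of its [r]-neighbourhood. *)
pose c := r / 40; have c0 : 0 < c by rewrite divr_gt0.
have cr : c <= r by rewrite /c; lra.
have [m0 m00 hm0] := circle_arc_uniform_gt0 hG nuG mL cG nuL c0.
have [k k0 hk] := uniform_copies Lp c0.
pose A := 2 `^ `|delta|; pose B := (20 / r) `^ delta.
have A0 : 0 < A by rewrite powR_gt0.
have r20 : 0 < 20 / r by rewrite divr_gt0.
have B0 : 0 < B by rewrite powR_gt0.
pose m := Num.min (B / A * m0) (A * B)^-1.
have m_1 : m <= B / A * m0 by rewrite ge_min lexx.
have m_2 : m <= (A * B)^-1 by rewrite ge_min lexx orbT.
have m_0 : 0 < m by rewrite lt_min mulr_gt0 ?divr_gt0// invr_gt0 mulr_gt0.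
pose k' := Num.min k (k * (10 / r)).
have k'k : k' <= k by rewrite ge_min lexx.
have k'2 : k' <= k * (10 / r) by rewrite ge_min lexx orbT.
exists m, k'; split => //; first by rewrite lt_min k0 mulr_gt0 ?divr_gt0.
move=> t ct e e0; have q0 : 0 < 10 * e / r by rewrite divr_gt0 ?mulr_gt0.
have [F [u [tau [lF Fu /andP[tau0 tauq] hF]]]] := hr t ct _ q0.
have dF := group_lift_pos_derivable hG lF.
have [Lu _] : conical G L (proj u) by apply: (conical_lift hG iL lF); rewrite Fu.
pose rho := tau * r / 20.
have rhoE : tau = 20 / r * rho by rewrite /rho; field; rewrite gt_eqF.
have rho0 : 0 < rho by rewrite /rho divr_gt0 ?mulr_gt0.
have tauE : tau `^ delta = B * rho `^ delta by rewrite rhoE powRM// ltW.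
have rhoe : rho < e.
  have : tau * r <= 10 * e by rewrite -ler_pdivlMr.
  by rewrite /rho; lra.
have P0 : 0 < rho `^ delta by rewrite powR_gt0.
have inF a b : u - r <= a -> b <= u + r -> forall s, s \in `[a, b] ->
    tau / 2 <= derive1 F s <= 2 * tau.
  move=> ua bu s; rewrite in_itv/= => /andP[s1 s2]; apply: hF.
  by rewrite ler_norml; clear - ua bu s1 s2; apply/andP; split; lra.
have [H lH hH] := hk u Lu.
have one2 : 1 <= 2 :> R by rewrite ler1n.
have tauc : 2 * tau * c = rho by rewrite /c /rho; field.
have taur : tau / 2 * (r / 2) = 5 * rho by rewrite /rho; field.
have taur' : 5 * rho <= tau / 2 * r.
  rewrite -taur; apply: ler_wpM2l; first by rewrite divr_ge0// ltW.
  by rewrite ler_pdivrMr// ler_peMr// ltW.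
exists rho, (F \o H); split; first by rewrite rho0.
split.
- have [|low _] := @conformal_circle_arc _ G hG _ _ nuG F (u - c) (u + c) 2 tau lF one2 tau0.
    by apply: inF; rewrite lerD2l ?lerN2.
  apply: (@le_trans _ _ (nu (circle_arc (F (u - c)) (F (u + c))))); last first.
    apply: le_measure; rewrite ?inE; [exact: measurable_circle_arc|exact: measurable_circle_arc|].
    have [h1 _ _ h2] := undistorted_ends dF hF (ltW c0) cr.
    by apply: circle_arcS; rewrite -tauc -Fu.
  apply: le_trans low.
  apply: (@le_trans _ _ ((tau `^ delta / A)%:E * m0%:E)%E); last first.
    by apply: lee_pmul; rewrite ?lee_fin ?divr_ge0 ?powR_ge0 ?hm0// ltW.
  rewrite -EFinM lee_fin tauE.
  have -> : B * rho `^ delta / A * m0 = B / A * m0 * rho `^ delta.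
    by field; rewrite gt_eqF.
  by rewrite ler_pM2r.
- have [|_ high] := @conformal_circle_arc _ G hG _ _ nuG F (u - r) (u + r) 2 tau lF one2 tau0.
    by apply: inF.
  apply: (@le_trans _ _ (nu (circle_arc (F (u - r)) (F (u + r))))).
    apply: le_measure; rewrite ?inE; [exact: measurable_circle_arc|exact: measurable_circle_arc|].
    have [_ h1 h2 _] := undistorted_ends dF hF (ltW r0) (lexx _).
    rewrite Fu in h1 h2; apply: circle_arcS.
      by apply: le_trans h1 _; rewrite lerD2l lerN2.
    by apply: le_trans h2; rewrite lerD2l.
  apply: (le_trans high).
  apply: (@le_trans _ _ ((A * tau `^ delta)%:E * 1)%E).
    apply: lee_pmul; rewrite ?lee_fin ?mulr_ge0 ?powR_ge0//.
    by apply: probability_le1; exact: measurable_circle_arc.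
  rewrite mule1 lee_fin tauE mulrA mulrC; apply: ler_wpM2l; first exact: ltW.
  by rewrite -[leLHS]invrK lef_pV2 ?posrE// invr_gt0 mulr_gt0.
- exact: group_lift_comp.
- move=> s ps; have [h1 h2] := hH s (lt_le_trans ps k'k).
  have hsu : `|H s - u| <= r by rewrite distrC; apply: le_trans (ltW h1) _.
  split.
    rewrite -Fu -tauc /=; apply: (undistorted_dist dF hF (ltW tau0)) => //.
    by rewrite distrC ltW.
  rewrite derive1_pos_comp//; last exact: (group_lift_pos_derivable hG lH).
  apply: (@le_trans _ _ (tau / 2 * k)).
    rewrite rhoE; have -> : 20 / r * rho / 2 * k = k * (10 / r) * rho.
      by field; rewrite gt_eqF.
    by rewrite ler_pM2r.
  apply: ler_pM => //; [by rewrite divr_ge0// ltW|exact: ltW|].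
  by have /andP[] := hF _ hsu.
Qed.

End Pieces.

(** * Hausdorff measure of self-similar compact sets *)

Section HausdorffLowerBound.
Context {R : realType} (T : metricType R).
Implicit Types (A B U : set T) (s d e : R).

(** In a cover of small total weight each set meets at most one of the separated
    images, so the sets meeting a given image form a strictly smaller family.
    Pulled back by the corresponding map they cover [A] again, and by induction
    their weight after this rescaling is at least [d0 `^ s]. Adding up over the
    maps contradicts the assumption on the [sigma i `^ s]. *)
Lemma separated_images_finite_cover A (I : finType) (phi : I -> T -> T)
    (sigma : I -> R) (d0 s : R) (i1 i2 : I) (x0 : T) :
  A x0 -> i1 != i2 -> 0 < d0 -> 0 < s ->
  (forall i x, A x -> A (phi i x)) ->
  (forall i, 0 < sigma i) ->
  (forall i x y, A x -> A y -> sigma i * mdist x y <= mdist (phi i x) (phi i y)) ->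
  (forall i j x y, i != j -> A x -> A y -> d0 <= mdist (phi i x) (phi j y)) ->
  1 < \sum_i sigma i `^ s ->
  forall (r : seq nat) (V : nat -> set T) (d : nat -> R),
  (forall k, k \in r -> 0 <= d k) ->
  (forall k x y, k \in r -> A x -> A y -> V k x -> V k y -> mdist x y <= d k) ->
  (forall x, A x -> exists2 k, k \in r & V k x) ->
  d0 `^ s <= \sum_(k <- r) d k `^ s.
Proof.
move=> Ax0 i12 d00 s0 Aphi sigma0 expand sep sum1 r.
have [n] := ubnP (size r); elim: n r => // n IH r /ltnSE rn V d d_ge0 Vd cov.
rewrite leNgt; apply/negP => small.
have dsmall k : k \in r -> d k < d0.
  move=> kr; rewrite ltNge; apply/negP => dk.
  move: small; apply/negP; rewrite -leNgt.
  apply: (@le_trans _ _ (d k `^ s)).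
    by apply: ge0_ler_powR => //; [exact: ltW|rewrite nnegrE ltW|rewrite nnegrE d_ge0].
  by rewrite (big_rem k)//= lerDl; apply: sumr_ge0 => j _; exact: powR_ge0.
pose hit i k := `[< exists2 x, A x & V k (phi i x) >].
have hit_uniq i j k : k \in r -> hit i k -> hit j k -> i = j.
  move=> kr /asboolP[x Ax Vx] /asboolP[y Ay Vy]; apply/eqP/negPn/negP => ij.
  have := sep i j x y ij Ax Ay; apply/negP; rewrite -ltNge.
  by apply: le_lt_trans (dsmall k kr); apply: Vd => //; exact: Aphi.
have hit_ex i : exists2 k, k \in r & hit i k.
  have [k kr Vk] := cov _ (Aphi i _ Ax0).
  by exists k => //; apply/asboolP; exists x0.
have pull i : sigma i `^ s * d0 `^ s <= \sum_(k <- r | hit i k) d k `^ s.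
  pose ri := [seq k <- r | hit i k].
  have ri_r : {subset ri <= r} by move=> k; rewrite mem_filter => /andP[].
  have szri : (size ri < n)%N.
    apply: leq_trans rn; rewrite size_filter -(count_predC (hit i) r) -addn1 leq_add2l.
    rewrite -has_count; apply/hasP.
    have [j ij] : exists j, i != j.
      by have [->|i1'] := eqVneq i i1; [exists i2|exists i1].
    have [k kr hk] := hit_ex j; exists k => //=.
    by apply/negP => hik; move: ij; rewrite (hit_uniq _ _ _ kr hik hk) eqxx.
  have := IH ri szri (fun k => phi i @^-1` V k) (fun k => d k / sigma i).
  have S0 : 0 < sigma i `^ s by rewrite powR_gt0.
  move=> H; rewrite -ler_pdivlMl//.
  apply: le_trans (H _ _ _) _.
  - by move=> k kri; rewrite divr_ge0// ?d_ge0 ?ri_r// ltW.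
  - move=> k x y kri Ax Ay Vx Vy; rewrite ler_pdivlMr// mulrC.
    apply: le_trans (expand i x y Ax Ay) _.
    by apply: (Vd k) => //; [exact: ri_r|exact: Aphi|exact: Aphi].
  - move=> x Ax; have [k kr Vk] := cov _ (Aphi i x Ax); exists k => //.
    by rewrite mem_filter kr andbT; apply/asboolP; exists x.
  - rewrite big_filter mulr_sumr le_eqVlt; apply/orP; left; apply/eqP.
    rewrite big_seq_cond [in RHS]big_seq_cond; apply: eq_bigr => k /andP[kr _].
    rewrite powRM ?d_ge0// ?invr_ge0 ?ltW//.
    by rewrite -(powR_inv1 (ltW (sigma0 i))) -powRrM mulN1r powRN mulrC.
have : \sum_i sigma i `^ s * d0 `^ s <= \sum_(k <- r) d k `^ s.
  apply: (@le_trans _ _ (\sum_i \sum_(k <- r | hit i k) d k `^ s)).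
    by apply: ler_sum => i _; exact: pull.
  rewrite (exchange_big_dep xpredT)//= big_seq [in leRHS]big_seq.
  apply: ler_sum => k kr; have [[i hik]|no] := pselect (exists i, hit i k).
    rewrite (big_pred1 i)// => j; apply/idP/eqP => [hjk|->//].
    exact: hit_uniq kr hjk hik.
  by rewrite big_pred0 ?powR_ge0// => i; apply/negP => hik; apply: no; exists i.
rewrite -mulr_suml; apply/negP; rewrite -ltNge; apply: lt_trans small _.
by rewrite ltr_pMl// powR_gt0.
Qed.

(** Raising the exponent does not increase the weight of a set of diameter at most
    one, and for a positive exponent the weight is continuous in the diameter. *)
Lemma open_thickening U (s' s e : R) : 0 <= s' -> s' < s -> 0 < e ->
  (mdiam U <= 1)%E ->
  exists V d, [/\ open V, U `<=` V, 0 <= d,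
    forall x y, V x -> V y -> mdist x y <= d &
    ((d `^ s)%:E <= hausdorff_weight s' U + e%:E)%E].
Proof.
move=> s'0 s's e0 U1; have s0 : 0 < s by exact: le_lt_trans s's.
have [U0|/set0P[z Uz]] := eqVneq U set0.
  exists set0, 0; split => //; [exact: open0|by rewrite U0|].
  by rewrite powR0 ?gt_eqF// /hausdorff_weight U0 eqxx add0e lee_fin ltW.
have diam x y : U x -> U y -> ((mdist x y)%:E <= mdiam U)%E.
  by move=> Ux Uy; apply: ereal_sup_ubound; exists x => //; exists y.
have zz := diam z z Uz Uz; rewrite mdistxx in zz.
have fU : mdiam U \is a fin_num.
  apply: fin_real; apply/andP; split; first exact: lt_le_trans (ltNyr _) zz.
  exact: le_lt_trans U1 (ltry _).
pose w := fine (mdiam U); have wE : mdiam U = w%:E by rewrite fineK.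
have w0 : 0 <= w by rewrite -lee_fin -wE.
have w1 : w <= 1 by rewrite -lee_fin -wE.
have ws : w `^ s <= w `^ s'.
  have [->|wn0] := eqVneq w 0; first by rewrite powR0 ?gt_eqF// powR_ge0.
  by apply: ger_powR; [rewrite lt_neqAle eq_sym wn0 w0|exact: ltW].
(* the new diameter [d] solves [d `^ s = w `^ s + e] *)
pose d := (w `^ s + e) `^ s^-1.
have p0 : 0 <= w `^ s + e by rewrite addr_ge0 ?powR_ge0 ?ltW.
have dE : d `^ s = w `^ s + e.
  by rewrite /d -powRrM mulVf ?gt_eqF// powRr1.
have wd : w < d.
  have -> : w = (w `^ s) `^ s^-1 by rewrite -powRrM divff ?gt_eqF// powRr1.
  by apply: gt0_ltr_powR; rewrite ?invr_gt0 ?nnegrE ?powR_ge0// ltrDl.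
pose eta := (d - w) / 2; have eta0 : 0 < eta by rewrite divr_gt0// subr_gt0.
exists (\bigcup_(y in U) (ball y eta)°), d; split.
- by apply: bigcup_open => y _; exact: open_interior.
- by move=> y Uy; exists y => //; exact: nbhsx_ballx.
- by apply: le_trans w0 (ltW wd).
- move=> x y [a Ua /interior_subset + [b Ub /interior_subset]]; rewrite !ballEmdist /= => ax by_.
  have ab : mdist a b <= w by rewrite -lee_fin -wE; exact: diam.
  have t1 := metric_triangle x a y; have t2 := metric_triangle a b y.
  by move: ax; rewrite metric_sym => ax; rewrite /eta in ax by_; lra.
- rewrite /hausdorff_weight; case: eqP => [U0|_]; first by move: Uz; rewrite U0.
  by rewrite wE poweR_EFin -EFinD lee_fin dE lerD2r.
Qed.

(** Thickening to open sets reduces arbitrary countable covers to finite ones, at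
    the cost of passing to a slightly smaller exponent. *)
Lemma separated_images_hausdorff_measure_neq0 A B (I : finType)
    (phi : I -> T -> T) (sigma : I -> R) (d0 s' s : R) (i1 i2 : I) (x0 : T) :
  compact A -> A `<=` B -> 0 <= s' -> s' < s ->
  A x0 -> i1 != i2 -> 0 < d0 ->
  (forall i x, A x -> A (phi i x)) ->
  (forall i, 0 < sigma i) ->
  (forall i x y, A x -> A y -> sigma i * mdist x y <= mdist (phi i x) (phi i y)) ->
  (forall i j x y, i != j -> A x -> A y -> d0 <= mdist (phi i x) (phi j y)) ->
  1 < \sum_i sigma i `^ s -> hausdorff_measure s' B <> 0%E.
Proof.
move=> cA AB s'0 s's Ax0 i12 d00 Aphi sigma0 expand sep sum1 H0.
have s0 : 0 < s by exact: le_lt_trans s's.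
pose e := d0 `^ s / 4; have e0 : 0 < e by rewrite divr_gt0// powR_gt0.
have : (hausdorff_content s' 1 B < e%:E)%E.
  apply: (@le_lt_trans _ _ 0%E); last by rewrite lte_fin.
  by rewrite -H0; apply: ereal_sup_ubound; exists 1 => //=.
move=> /ereal_inf_lt[_ [U [BU U1] <-]] sumU.
have e2 k : 0 < e / (2 ^ k)%:R by rewrite divr_gt0// ltr0n expn_gt0.
have /choice[Vd hVd] : forall k, exists Vd : set T * R, [/\ open Vd.1, U k `<=` Vd.1, 0 <= Vd.2,
    forall x y, Vd.1 x -> Vd.1 y -> mdist x y <= Vd.2 &
    ((Vd.2 `^ s)%:E <= hausdorff_weight s' (U k) + (e / (2 ^ k)%:R)%:E)%E].
  by move=> k; have [V [d h]] := open_thickening s'0 s's (e2 k) (U1 k); exists (V, d).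
have [N _ /(_ N (leqnn _)) covN] : \forall n \near \oo,
    A `<=` (fun x => exists2 k, (k < n)%N & (Vd k).1 x).
  apply: (compact_near_coveringP A).1 => // x Ax.
  have [k _ Ux] := BU _ (AB _ Ax); have [oV UV _ _ _] := hVd k.
  exists ((Vd k).1, [set n | (k < n)%N]); last by move=> [y n] [/= Vy kn]; exists k.
  split; last by exists k.+1.
  by move: oV; rewrite openE; apply; exact: UV.
have /negP : ~~ (d0 `^ s <= \sum_(k <- iota 0 N) (Vd k).2 `^ s).
  rewrite -ltNge.
  have wge0 k : (0 <= hausdorff_weight s' (U k))%E.
    by rewrite /hausdorff_weight; case: ifP => // _; exact: poweR_ge0.
  have geo : \sum_(0 <= k < N) e / (2 ^ k)%:R <= 2 * e.
    have : \sum_(0 <= k < N) e / (2 ^ k)%:R = 2 * e - 2 * e / (2 ^ N)%:R.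
      elim: (N) => [|n IH]; first by rewrite big_geq// expn0 divr1 subrr.
      rewrite big_nat_recr//= IH expnS natrM; field.
      by rewrite pnatr_eq0 -lt0n expn_gt0.
    by move=> ->; rewrite gerBl divr_ge0// mulr_ge0// ltW.
  have : ((\sum_(k <- iota 0 N) (Vd k).2 `^ s)%:E < (e + 2 * e)%:E)%E.
    have -> : iota 0 N = index_iota 0 N by rewrite /index_iota subn0.
    rewrite EFinD -sumEFin.
    apply: (@le_lt_trans _ _ (\sum_(0 <= k < N) (hausdorff_weight s' (U k) + (e / (2 ^ k)%:R)%:E))%E).
      by apply: lee_sum => k _; have [] := hVd k.
    rewrite big_split/= sumEFin; apply: lte_leD => //.
    by apply: le_lt_trans sumU; apply: nneseries_lim_ge => k _ _; exact: wge0.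
  by rewrite lte_fin => /lt_trans; apply; rewrite /e; have := powR_gt0 s d00; lra.
apply; apply: (separated_images_finite_cover Ax0 i12 d00 s0 Aphi sigma0 expand sep sum1
  (V := fun k => (Vd k).1)).
- by move=> k _; have [_ _ dk0 _ _] := hVd k.
- by move=> k x y _ _ _ Vx Vy; have [_ _ _ h _] := hVd k; exact: h.
- by move=> x /covN[k kN Vx]; exists k => //; rewrite mem_iota.
Qed.

End HausdorffLowerBound.

(** * Covering tools *)

Section Tools.
Context {R : realType}.

Lemma countable_enumeration (Z : Type) (D : set Z) : countable D ->
  exists f : nat -> option Z, exists g : Z -> nat, [/\ ocancel f g,
    forall n z, f n = Some z -> D z & forall z, D z -> f (g z) = Some z].
Proof.
move=> /countable_injP[g ginj].
have /choice[f hf] : forall n, exists oz : option Z,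
    match oz with Some z => D z /\ g z = n | None => forall z, D z -> g z <> n end.
  move=> n; have [[z Dzn]|no] := pselect (exists z, D z /\ g z = n); first by exists (Some z).
  by exists None => z Dz gz; apply: no; exists z.
exists f, g; split.
- by move=> n; have := hf n; case: (f n) => //= z [].
- by move=> n z E; have := hf n; rewrite E => -[].
- move=> z Dz; have := hf (g z); case: (f (g z)) => [w [Dw]|/(_ z Dz)//].
  by move=> /ginj; rewrite !inE => ->.
Qed.

Lemma big_enumeration (Z : Type) (V : nmodType) (f : nat -> option Z) (a : Z -> V) N :
  \sum_(0 <= n < N) (if f n is Some z then a z else 0) = \sum_(z <- pmap f (iota 0 N)) a z.
Proof.
rewrite /index_iota subn0; elim: (iota 0 N) => [|n r IH]; first by rewrite !big_nil.
by rewrite big_cons IH /=; case: (f n) => [z|] /=; rewrite ?big_cons ?add0r.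
Qed.

Lemma vitali_closed_balls (S : set R) (rho : R -> R) (r0 : R) :
  (forall t, 0 < rho t) -> (forall t, S t -> rho t <= r0) ->
  exists D, [/\ countable D, D `<=` S,
    forall s t, D s -> D t -> s != t -> rho s + rho t < `|s - t| &
    forall t, S t -> exists2 s, D s & `|s - t| <= 5 * rho s].
Proof.
move=> rho0 rhoS; pose B t : set R := ball t (rho t).
have radB t : (radius (B t))%:num = rho t by rewrite radius_ball_num// ltW.
have [|||D [cD DS tD covD]] := @vitali_lemma_infinite_cover R R B S r0.
- by move=> t; exact: is_ball_ball.
- by move=> t; rewrite radB.
- by move=> t St; rewrite radB; exact: rhoS.
have clB t x : closure (B t) x <-> `|t - x| <= rho t.
  by rewrite closure_ballE closed_ballE.
exists D; split => //.
- move=> s t Ds Dt st; rewrite ltNge; apply/negP => close.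
  have p0 : 0 < rho s + rho t by rewrite addr_gt0.
  have q0 w : 0 <= rho w / (rho s + rho t) by rewrite divr_ge0// ltW.
  suff : (closure (B s) `&` closure (B t)) !=set0.
    by move=> /(tD _ _ Ds Dt)/eqP; rewrite (negbTE st).
  (* the point dividing the segment in the ratio of the radii *)
  exists (s + (t - s) * (rho s / (rho s + rho t))); split; apply/clB.
    rewrite opprD addrA subrr sub0r normrN normrM [`|rho s / _|]ger0_norm ?q0//.
    by rewrite mulrCA ger_pMr// ler_pdivrMr// mul1r distrC.
  have -> : t - (s + (t - s) * (rho s / (rho s + rho t))) = (t - s) * (rho t / (rho s + rho t)).
    by field; rewrite gt_eqF.
  rewrite normrM [`|rho t / _|]ger0_norm ?q0//.
  by rewrite mulrCA ger_pMr// ler_pdivrMr// mul1r distrC.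
- move=> t St; have [|s Ds] := covD t.
    by exists t => //; apply/clB; rewrite subrr normr0 ltW.
  rewrite /= /B scale_ballE// closure_ballE closed_ballE ?mulr_gt0// => st.
  by exists s.
Qed.

Lemma disjoint_sum_le1 d (T : measurableType d) (P : probability T R) (Z : eqType)
    (M : Z -> set T) (s : seq Z) : uniq s ->
  (forall z, measurable (M z)) ->
  (forall y z, y \in s -> z \in s -> y != z -> M y `&` M z = set0) ->
  (\sum_(z <- s) P (M z) <= 1)%E.
Proof.
move=> us mM dM.
suff [U [mU UE <-]] : exists U, [/\ measurable U, U `<=` [set x | exists2 z, z \in s & M z x] &
    P U = (\sum_(z <- s) P (M z))%E] by exact: probability_le1.
elim: s us dM => [|y s IH] /= us dM.
  by exists set0; split => //; rewrite big_nil measure0.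
move: us => /andP[ys us]; have [|U [mU UE PU]] := IH us.
  by move=> w z ws zs; apply: dM; rewrite inE ?ws ?zs orbT.
exists (M y `|` U); split; first exact: measurableU.
  move=> x [Mx|/UE[z zs Mz]]; first by exists y; rewrite ?inE ?eqxx.
  by exists z => //; rewrite inE zs orbT.
have dyU : M y `&` U = set0.
  apply/seteqP; split => // x [Mx /UE[z zs Mz]].
  suff : (M y `&` M z) x by rewrite dM ?inE ?eqxx ?zs ?orbT//; apply: contraNneq ys => ->.
  by split.
rewrite measureU// big_cons; congr (_ + _)%E; exact: PU.
Qed.

Lemma small_power (a c : R) : 0 < a -> 0 < c ->
  exists2 e, 0 < e & forall x, 0 < x -> x < e -> x `^ a <= c.
Proof.
move=> a0 c0; exists (c `^ a^-1); first by rewrite powR_gt0.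
move=> x x0 xe; apply: (@le_trans _ _ ((c `^ a^-1) `^ a)).
  by apply: ge0_ler_powR; rewrite ?nnegrE ?powR_ge0// ltW.
by rewrite -powRrM mulVf ?gt_eqF// powRr1// ltW.
Qed.

Lemma hausdorff_measure_eq0 (T : metricType R) (A : set T) (s : R) :
  (forall e, 0 < e -> exists U : nat -> set T, [/\ A `<=` \bigcup_n U n,
    forall n, (mdiam (U n) <= e%:E)%E &
    (\sum_(0 <= n <oo) hausdorff_weight s (U n) <= e%:E)%E]) ->
  hausdorff_measure s A = 0%E.
Proof.
move=> H.
have w0 (U : set T) : (0 <= hausdorff_weight s U)%E.
  by rewrite /hausdorff_weight; case: ifP => // _; exact: poweR_ge0.
have c0 e : 0 < e -> hausdorff_content s e A = 0%E.
  move=> e0; apply/eqP; rewrite eq_le; apply/andP; split; last first.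
    by apply: le_ereal_inf_tmp => _ [U _ <-]; apply: nneseries_ge0 => n _ _; exact: w0.
  apply/lee_addgt0Pr => d d0; rewrite add0e.
  have m0 : 0 < Num.min d e by rewrite lt_min d0.
  have [U [AU Ue Us]] := H _ m0.
  apply: (@le_trans _ _ (\sum_(0 <= n <oo) hausdorff_weight s (U n))%E).
    apply: ereal_inf_lbound; exists U => //; split => // n.
    by apply: le_trans (Ue n) _; rewrite lee_fin ge_min lexx orbT.
  by apply: le_trans Us _; rewrite lee_fin ge_min lexx.
rewrite /hausdorff_measure.
have -> : [set hausdorff_content s e A | e in [set e : R | (0 < e)%R]] = [set 0%E].
  apply/seteqP; split => [_ [e /= e0 <-]|_ ->]; first by rewrite /= c0.
  by exists 1; rewrite //= c0.
exact: ereal_sup1.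
Qed.

Lemma hausdorff_weight_le (T : metricType R) (U : set T) (s d : R) : 0 <= s -> 0 <= d ->
  (forall x y, U x -> U y -> mdist x y <= d) ->
  (mdiam U <= d%:E)%E /\ (hausdorff_weight s U <= (d `^ s)%:E)%E.
Proof.
move=> s0 d0 Ud.
have dU : (mdiam U <= d%:E)%E.
  by apply: ge_ereal_sup => _ [x Ux [y Uy <-]]; rewrite lee_fin; exact: Ud.
split => //; rewrite /hausdorff_weight; case: ifPn => [_|/set0P[z Uz]].
  by rewrite lee_fin powR_ge0.
rewrite -poweR_EFin; apply: gt0_ler_poweR => //; rewrite in_itv/= leey andbT.
- apply: (@le_trans _ _ (mdist z z)%:E); first by rewrite mdistxx.
  by apply: ereal_sup_ubound; exists z => //; exists z.
- by rewrite lee_fin.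
Qed.

Lemma series_le (a : nat -> \bar R) (B : \bar R) : (forall n, (0 <= a n)%E) ->
  (forall N, (\sum_(0 <= n < N) a n <= B)%E) -> (\sum_(0 <= n <oo) a n <= B)%E.
Proof.
by move=> a0 aB; apply: lime_le; [exact: is_cvg_nneseries|exact: nearW].
Qed.

End Tools.

(** * The dimension of the minimal set *)

Section Dimension.
Context {R : realType} (G : set (circle R -> circle R)) (hG : subgroup_Diff2_plus G).
Hypothesis fg : finitely_generated G.
Local Notation proj := (@circle_proj R).
Variable L : set (circle R).
Hypothesis mL : minimal_set G L.
Hypothesis hstar : property_Lambda_star G L.
Variables (delta : R) (nu : probability (borel_circle R) R).
Hypothesis nuG : conformal_measure G delta nu.
Hypothesis nu_atomless : atomless nu.
Hypothesis nuL : supported_on nu L.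

Let cG : countable G := finitely_generated_countable hG fg.

Lemma nonconical_negligible : nu.-negligible (L `\` conical G L : set (borel_circle R)).
Proof.
have [_ cL _ _] := mL.
have [f [g [_ fD fg']]] := countable_enumeration (nonconical_countable hG cL hstar fg).
pose F n : set (borel_circle R) := if f n is Some x then [set x] else set0.
apply: (@negligibleS _ _ _ _ (\bigcup_n F n)).
  by move=> x Dx; exists (g x) => //; rewrite /F fg'.
apply: negligible_bigcup => n; rewrite /F; case: (f n) => [x|]; last exact: negligible_set0.
exists [set x]; split => //; last exact: nu_atomless.
apply: measurable_closed_circle.
exact: (accessible_closed_set1 (hausdorff_accessible (@metric_hausdorff R (circle R)))).
Qed.

Lemma conical_nonempty : exists t, conical G L (proj t).
Proof.
have [_ cL _ _] := mL.
apply: contrapT => /forallNP N.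
have : nu.-negligible ([set: borel_circle R]).
  apply: negligibleS (negligibleU nonconical_negligible
    (_ : nu.-negligible (~` (L : set (borel_circle R))))).
    move=> x _; have [Lx|] := pselect (L x); last by right.
    by left; split => // cx; have [t _ E] := proj_surj x 0; apply: (N t); rewrite E.
  exists (~` (L : set (borel_circle R))); split => //.
  by apply: measurableC; exact: measurable_closed_circle.
move=> /negligibleP -/(_ measurableT) N0.
have /eqP : (1 : \bar R)%E = 0%E by rewrite -(probability_setT nu); exact: N0.
by rewrite onee_eq0.
Qed.

(** Otherwise small arcs would have measure larger than one. *)
Lemma conformal_exponent_ge0 : 0 <= delta.
Proof.
have [t ct] := conical_nonempty.
have [m [k [m0 k0 hmk]]] := conical_good_scales hG mL hstar nuG cG nuL ct.1.
rewrite leNgt; apply/negP => d0.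
have [||e e0 he] := @small_power R (- delta) (m / 2); [by rewrite oppr_gt0|by rewrite divr_gt0|].
have [rho [F [/andP[rho0 rhoe] [h1 _ _ _]]]] := hmk t ct e e0.
have := le_trans h1 (probability_le1 nu (measurable_circle_arc _ _)).
rewrite lee_fin; apply/negP; rewrite -ltNge.
have := he rho rho0 rhoe; rewrite powRN => h.
have P0 : 0 < rho `^ delta by rewrite powR_gt0.
have : 1 <= m / 2 * rho `^ delta by rewrite -ler_pdivrMr// mul1r.
by rewrite mulrAC; lra.
Qed.

(** Vitali's covering lemma selects disjoint good balls whose enlargements cover
    the conical points; the sum of the weights of the enlargements is bounded
    by a small multiple of the total mass. *)
Lemma hausdorff_measure_above s : delta < s -> hausdorff_measure s L = 0%E.
Proof.
move=> ds; have dge0 := conformal_exponent_ge0; have s0 : 0 < s by exact: le_lt_trans ds.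
have [t0 ct0] := conical_nonempty; have [_ cL _ _] := mL.
have [m [k [m0 k0 hmk]]] := conical_good_scales hG mL hstar nuG cG nuL ct0.1.
apply: hausdorff_measure_eq0 => e e0.
pose C := 10 `^ s / m * 2; have C0 : 0 < C by rewrite mulr_gt0// divr_gt0// powR_gt0.
have [||eta eta0 heta] := @small_power R (s - delta) (e / C); [by rewrite subr_gt0|by rewrite divr_gt0|].
pose r0 := Num.min eta (Num.min (e / 10) (1 / 8)).
have r00 : 0 < r0 by rewrite !lt_min eta0 !divr_gt0.
have [r1 r2 r3] : [/\ r0 <= eta, r0 <= e / 10 & r0 <= 1 / 8].
  by split; rewrite !ge_min lexx ?orbT.
have /choice[rho hrho] : forall t, exists r, 0 < r /\ (conical G L (proj t) ->
    r < r0 /\ ((m * r `^ delta)%:E <= nu (circle_arc (t - r) (t + r)))%E).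
  move=> t; have [ct|nct] := pselect (conical G L (proj t)); last by exists 1.
  by have [r [F [/andP[a b] [h _ _ _]]]] := hmk t ct r0 r00; exists r.
pose S := `[0, 1]%classic `&` proj @^-1` conical G L.
have [||D [cD DS Dsep Dcov]] := @vitali_closed_balls R S rho r0.
- by move=> t; have [] := hrho t.
- by move=> t [_ ct]; have [_ /(_ ct)[/ltW]] := hrho t.
pose Z : eqType := (R + circle R)%type.
pose DZ : set Z := [set z | match z with inl t => D t | inr x => (L `\` conical G L) x end].
have cDZ : countable DZ.
  have -> : DZ = inl @` D `|` inr @` (L `\` conical G L).
    apply/seteqP; split => [[t|x] h|_ [[t Dt <-]|[x Dx <-]]] //.
      by left; exists t.
    by right; exists x.
  rewrite -bigcup2E; apply: bigcup_countable => // -[|[|i]] _ //=.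
    exact: sub_countable (card_image_le _ _) cD.
  exact: sub_countable (card_image_le _ _) (nonconical_countable hG cL hstar fg).
have [f [g [fK fD fg']]] := countable_enumeration cDZ.
pose U (z : Z) : set (circle R) :=
  match z with inl t => circle_arc (t - 5 * rho t) (t + 5 * rho t) | inr x => [set x] end.
(* Balls centred in the same half of [0, 1] have disjoint projections, so the
   total mass of each half is at most one. *)
pose M (b : bool) (z : Z) : set (borel_circle R) :=
  if z is inl t then if `[< D t /\ (t <= 1 / 2) = b >] then circle_arc (t - rho t) (t + rho t)
  else set0 else set0.
have mM b z : measurable (M b z).
  rewrite /M; case: z => [t|x]; last exact: measurable0.
  by case: ifP => _; [exact: measurable_circle_arc|exact: measurable0].
pose K := 10 `^ s * (e / C) / m.
have K0 : 0 <= K by rewrite /K !mulr_ge0 ?powR_ge0 ?invr_ge0 ?ltW.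
have hU z : DZ z -> (mdiam (U z) <= e%:E)%E /\
    (hausdorff_weight s (U z) <= K%:E * (nu (M true z) + nu (M false z)))%E.
  case: z => [t Dt|x _] /=; last first.
    have [|h1 h2] := @hausdorff_weight_le R (circle R) [set x] s 0 (ltW s0) (lexx _).
      by move=> y z -> ->; rewrite mdistxx.
    split; first by apply: le_trans h1 _; rewrite lee_fin ltW.
    by apply: le_trans h2 _; rewrite powR0 ?gt_eqF// measure0 adde0 mule0.
  have [tp /(_ (DS _ Dt).2)[tr tm]] := hrho t.
  have [||h1 h2] := @hausdorff_weight_le R (circle R) (U (inl t)) s (10 * rho t) (ltW s0).
  - by rewrite mulr_ge0// ltW.
  - move=> x y [a aI <-] [b bI <-]; apply: le_trans (mdist_proj_le _ _) _.
    move: aI bI; rewrite /= !in_itv/= => /andP[a1 a2] /andP[b1 b2].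
    by rewrite ler_norml; apply/andP; split; lra.
  split; first by apply: le_trans h1 _; rewrite lee_fin; lra.
  apply: le_trans h2 _.
  have -> : (nu (M true (inl t)) + nu (M false (inl t)) =
      nu (circle_arc (t - rho t) (t + rho t)))%E.
    rewrite /M; case: (boolP (t <= 1 / 2)) => th.
      by rewrite asboolT// asboolF ?measure0 ?adde0// => -[].
    by rewrite asboolF ?asboolT ?measure0 ?add0e// => -[].
  apply: (@le_trans _ _ (K%:E * (m * rho t `^ delta)%:E)%E); last by apply: lee_wpmul2l; rewrite ?lee_fin.
  rewrite -EFinM lee_fin powRM// ?(ltW tp)//.
  have -> : rho t `^ s = rho t `^ delta * rho t `^ (s - delta).
    by rewrite -powRD ?subrKC//; apply/implyP => _; rewrite gt_eqF.
  have -> : K * (m * rho t `^ delta) = 10 `^ s * (rho t `^ delta * (e / C)).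
    by rewrite /K; field; rewrite !gt_eqF.
  apply: ler_wpM2l; first exact: powR_ge0.
  apply: ler_wpM2l; first exact: powR_ge0.
  by apply: heta => //; exact: lt_le_trans r1.
have w0 (V : set (circle R)) : (0 <= hausdorff_weight s V)%E.
  by rewrite /hausdorff_weight; case: ifP => // _; exact: poweR_ge0.
exists (fun n => if f n is Some z then U z else set0); split.
- move=> x Lx; have [cx|ncx] := pselect (conical G L x).
    have [t] := proj_surj x 0; rewrite add0r => tI tx.
    have [|v Dv vt] := Dcov t; first by split => //=; rewrite /preimage /= tx.
    exists (g (inl v)) => //; rewrite fg'//=; exists t => //.
    by move: vt; rewrite /= in_itv/= ler_norml => /andP[? ?]; apply/andP; split; lra.
  by exists (g (inr x)) => //; rewrite fg'.
- move=> n; case E: (f n) => [z|]; first by have [] := hU z (fD _ _ E).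
  by apply: ge_ereal_sup => y [x []].
- apply: series_le => [n|N]; first exact: w0.
  have us : uniq (pmap f (iota 0 N)) by apply: (pmap_uniq fK); exact: iota_uniq.
  have sD z : z \in pmap f (iota 0 N) -> DZ z.
    by rewrite mem_pmap => /mapP[n _ /esym/fD].
  rewrite (eq_bigr (fun n => if f n is Some z then hausdorff_weight s (U z) else 0%E)); last first.
    by move=> n _; case: (f n) => // ; rewrite /hausdorff_weight eqxx.
  rewrite (@big_enumeration Z (\bar R) f (fun z => hausdorff_weight s (U z))).
  have disj b y z : y \in pmap f (iota 0 N) -> z \in pmap f (iota 0 N) -> y != z ->
      M b y `&` M b z = set0.
    rewrite /M; case: y z => [t|x] [t'|x'] ty tz tt; rewrite ?setI0 ?set0I//.
    case: ifP => [/asboolP[Dt tb]|_]; last by rewrite set0I.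
    case: ifP => [/asboolP[Dt' tb']|_]; last by rewrite setI0.
    apply/seteqP; split => // x [[a aI ax] [b' bI bx]].
    have tt' : t != t' by apply: contraNneq tt => ->.
    have [tp /(_ (DS _ Dt).2)[tr _]] := hrho t; have [tp' /(_ (DS _ Dt').2)[tr' _]] := hrho t'.
    have [tI _] := DS _ Dt; have [tI' _] := DS _ Dt'.
    have := Dsep _ _ Dt Dt' tt'; have pab : proj a = proj b' by rewrite ax.
    move: aI bI tI tI'; rewrite /= !in_itv/= => /andP[a1 a2] /andP[b1 b2] /andP[t1 t2] /andP[t1' t2'].
    have ab : `|a - b'| < 1.
      rewrite ltr_norml; move: tb tb'; case: b => [|/negbT + /negbT]; rewrite -?ltNge => tb tb';
        by apply/andP; split; lra.
    have E := proj_locally_inj ab pab; rewrite E in a1 a2.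
    by rewrite ltNge ler_norml => /negP; apply; apply/andP; split; lra.
  apply: (@le_trans _ _ (\sum_(z <- pmap f (iota 0 N)) K%:E * (nu (M true z) + nu (M false z)))%E).
    rewrite big_seq [in leRHS]big_seq; apply: lee_sum => z /sD Dz.
    by have [] := hU z Dz.
  rewrite -ge0_sume_distrr; last by move=> z _; rewrite adde_ge0.
  rewrite big_split/=.
  apply: (@le_trans _ _ (K%:E * (1 + 1))%E).
    apply: lee_pmul => //; first by rewrite adde_ge0// sume_ge0.
    by apply: leeD; apply: disjoint_sum_le1 => //; exact: disj.
  rewrite -EFinD -EFinM lee_fin le_eqVlt; apply/orP; left; apply/eqP.
  by rewrite /K /C; field; rewrite !gt_eqF// powR_gt0.
Qed.

(** The nonconical points of the arc form a null set, so the enlarged balls carry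
    its whole mass and a partial sum of their measures exceeds [v]. *)
Lemma finite_mass_subfamily (D : set R) (rho : R -> R) (a b v : R) :
  countable D -> (v%:E < nu (circle_arc a b))%E ->
  (forall t, t \in `[a, b] -> conical G L (proj t) ->
     exists2 s, D s & `|s - t| <= 5 * rho s) ->
  exists s : seq R, [/\ uniq s, forall t, t \in s -> D t &
    (v%:E < \sum_(t <- s) nu (circle_arc (t - 5 * rho t) (t + 5 * rho t)))%E].
Proof.
move=> cD vlt cov; have [_ cL _ _] := mL.
have [f [g [fK fD fg']]] := countable_enumeration cD.
pose A t : set (borel_circle R) := circle_arc (t - 5 * rho t) (t + 5 * rho t).
pose W n : set (borel_circle R) := if f n is Some t then A t else set0.
have mW n : measurable (W n).
  by rewrite /W; case: (f n) => [t|]; [exact: measurable_circle_arc|exact: measurable0].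
have [N [mN N0 NL]] : nu.-negligible
    ((L `\` conical G L : set (borel_circle R)) `|` ~` (L : set (borel_circle R))).
  apply: negligibleU; first exact: nonconical_negligible.
  exists (~` (L : set (borel_circle R))); split => //.
  by apply: measurableC; exact: measurable_closed_circle.
have mUW : measurable (\bigcup_n W n) by exact: bigcup_measurable.
have sub : circle_arc a b `<=` N `|` \bigcup_n W n.
  move=> x [t tI <-]; have [ct|nct] := pselect (conical G L (proj t)).
    have [s Ds st] := cov t tI ct; right; exists (g s) => //; rewrite /W fg'//.
    exists t => //=; rewrite in_itv/=.
    by move: st; rewrite ler_norml => /andP[? ?]; apply/andP; split; lra.
  left; apply: NL; have [Lt|] := pselect (L (proj t)); last by right.
  by left.
have le1 : (nu (circle_arc a b) <= \sum_(0 <= n <oo) nu (W n))%E.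
  apply: (@le_trans _ _ (nu (N `|` \bigcup_n W n))).
    by apply: le_measure; rewrite ?inE//; [exact: measurable_circle_arc|exact: measurableU].
  apply: (@le_trans _ _ (nu N + nu (\bigcup_n W n))%E); first exact: measureU2.
  rewrite [nu N]N0 add0e; exact: generalized_Boole_inequality.
have [M hM] : exists M, (v%:E < \sum_(0 <= n < M) nu (W n))%E.
  apply: contrapT => /forallNP no; move: vlt; apply/negP; rewrite -leNgt.
  apply: le_trans le1 _; apply: series_le => // M.
  by rewrite leNgt; apply/negP/no.
exists (pmap f (iota 0 M)); split.
- by apply: (pmap_uniq fK); exact: iota_uniq.
- by move=> t; rewrite mem_pmap => /mapP[n _ /esym/fD].
- rewrite -(big_enumeration f (fun t => nu (A t))).
  apply: lt_le_trans hM _; apply: lee_sum => n _.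
  by rewrite /W; case: (f n) => //; rewrite measure0.
Qed.

(** Below the exponent of the measure, the copies inside finitely many disjoint
    good balls form a system of separated similar copies of a piece of the
    minimal set whose [s]-weights add up to more than one. *)
Lemma hausdorff_measure_below s' : 0 <= s' -> s' < delta -> hausdorff_measure s' L <> 0%E.
Proof.
move=> s'0 s'd; pose s := (s' + delta) / 2.
have s's : s' < s by rewrite /s; lra.
have sd : s < delta by rewrite /s; lra.
have s0 : 0 < s by lra.
have [p [Lp _]] := conical_nonempty.
have [_ cL iL _] := mL.
have [m [k [m0 k0 hmk]]] := conical_good_scales hG mL hstar nuG cG nuL Lp.
pose k1 := Num.min (k / 2) (1 / 8).
have k10 : 0 < k1 by rewrite lt_min !divr_gt0.
have [k1k k18] : k1 < k /\ k1 <= 1 / 8.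
  have h1 : k1 <= k / 2 by rewrite ge_min lexx.
  have h2 : k1 <= 1 / 8 by rewrite ge_min lexx orbT.
  by split => //; lra.
have k120 : 0 < k1 / 2 by rewrite divr_gt0.
have v0 := circle_arc_gt0 hG nuG mL cG nuL Lp k120.
have [v v_0 vlt] : exists2 v, 0 < v & (v%:E < nu (circle_arc (p - k1 / 2) (p + k1 / 2)))%E.
  set n := nu _ in v0 *; have fn : n \is a fin_num.
    by apply: fin_num_measure; exact: measurable_circle_arc.
  have : 0 < fine n by rewrite fine_gt0// v0 ltey_eq fn.
  exists (fine n / 2); first by rewrite divr_gt0.
  by rewrite -[ltRHS]fineK// lte_fin; lra.
have kp0 : 0 < k `^ s by rewrite powR_gt0.
(* radii below [eta] turn the bound [v * m] on the [delta]-weights into a bound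
   by two on the [s]-weights of the copies *)
have [||eta eta0 heta] := @small_power R (delta - s) (k `^ s * (v * m) / 2).
- by rewrite subr_gt0.
- by rewrite divr_gt0// !mulr_gt0.
pose r0 := Num.min eta (Num.min (k1 / 2) k^-1).
have r00 : 0 < r0 by rewrite !lt_min eta0 k120 invr_gt0.
have [r1 r2 r3] : [/\ r0 <= eta, r0 <= k1 / 2 & r0 <= k^-1].
  by split; rewrite !ge_min lexx ?orbT.
have /choice[c hc] : forall t, exists c : R * (R -> R) * (circle R -> circle R),
    0 < c.1.1 /\ (conical G L (proj t) -> [/\ c.1.1 < r0,
    good_scale G delta nu p m k t c.1.1 c.1.2, G c.2 & monotone_lift c.2 c.1.2]).
  move=> t; have [ct|nct] := pselect (conical G L (proj t)).
    have [r [F [/andP[a b] h]]] := hmk t ct r0 r00; have [_ _ [g Gg lF] _] := h.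
    by exists (r, F, g).
  by exists (1, id, id).
pose rho t := (c t).1.1.
pose S := `[p - k1 / 2, p + k1 / 2]%classic `&` proj @^-1` conical G L.
have [||D [cD DS Dsep Dcov]] := @vitali_closed_balls R S rho r0.
- by move=> t; have [] := hc t.
- by move=> t [_ ct]; have [_ /(_ ct)[/ltW]] := hc t.
have [|l [ul lD lsum]] := @finite_mass_subfamily D rho _ _ v cD vlt.
  by move=> t tI ct; exact: Dcov.
pose I := 'I_(size l); pose tt (i : I) := tnth (in_tuple l) i.
have ttD i : D (tt i) by apply: lD; exact: mem_tnth.
have tt_inj i j : i != j -> tt i != tt j.
  by move=> ij; rewrite /tt !(tnth_nth 0) nth_uniq.
have good i := (hc (tt i)).2 (DS _ (ttD i)).2.
have rho0 i : 0 < rho (tt i) by have [] := hc (tt i).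
pose sigma i := k * rho (tt i).
have sigma0 i : 0 < sigma i by rewrite mulr_gt0.
have sum_delta : v * m < \sum_i rho (tt i) `^ delta.
  rewrite -ltr_pdivlMr// mulr_suml -lte_fin -sumEFin; apply: lt_le_trans lsum _.
  rewrite big_tnth; apply: lee_sum => i _.
  by have [_ [_ h _ _] _ _] := good i.
have sum_s : 2 < \sum_i sigma i `^ s.
  have step i : rho (tt i) `^ delta <= v * m / 2 * sigma i `^ s.
    have -> : rho (tt i) `^ delta = rho (tt i) `^ s * rho (tt i) `^ (delta - s).
      by rewrite -powRD ?subrKC//; apply/implyP => _; rewrite gt_eqF.
    have -> : v * m / 2 * sigma i `^ s = rho (tt i) `^ s * (k `^ s * (v * m) / 2).
      by rewrite /sigma powRM ?ltW//; field.
    apply: ler_wpM2l; first exact: powR_ge0.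
    by apply: heta => //; have [h _ _ _] := good i; exact: lt_le_trans r1.
  have : v * m < v * m / 2 * \sum_i sigma i `^ s.
    by apply: lt_le_trans sum_delta _; rewrite mulr_sumr; exact: ler_sum.
  by rewrite mulrAC -mulrA ltr_pMr ?mulr_gt0// ltr_pdivlMr// mul1r.
(* each copy has weight at most one *)
have size2 : (1 < size l)%N.
  rewrite ltnNge; apply/negP => l1; move: sum_s; apply/negP; rewrite -leNgt.
  apply: (@le_trans _ _ (\sum_(i : I) 1)); last first.
    by rewrite sumr_const card_ord (ler_nat R (size l) 2); exact: leq_trans l1 _.
  apply: ler_sum => i _; apply: (@le_trans _ _ (1 `^ s)); last by rewrite powR1.
  have sigma1 : sigma i <= 1.
    have [h _ _ _] := good i; rewrite /sigma -ler_pdivlMl// mulr1.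
    exact: le_trans (ltW h) r3.
  by apply: ge0_ler_powR => //; rewrite ?nnegrE ltW.
have size1 : (0 < size l)%N by exact: ltnW.
pose A := L `&` (circle_arc (p - k1) (p + k1) : set (circle R)).
have cA : compact A.
  by apply: circle_compact; apply: closedI => //; exact: proj_itv_closed.
pose F i := (c (tt i)).1.2; pose phi i := (c (tt i)).2.
have Fball i a : a \in `[p - k1, p + k1] ->
    [/\ proj (F i a) = phi i (proj a), `|F i a - tt i| <= rho (tt i) & F i a \in `[p - k1, p + k1]].
  rewrite in_itv/= => /andP[a1 a2]; have [h [_ _ _ hF] _ [[_ pF] _]] := good i.
  have [|h1 _] := hF a; first by rewrite ltr_norml; apply/andP; split; lra.
  split => //; first exact: pF.
  have [tI _] := DS _ (ttD i).
  have : `|F i a - tt i| <= r0 by exact: le_trans h1 (ltW h).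
  move: tI; rewrite /= !in_itv/= ler_norml => /andP[t1 t2] /andP[q1 q2].
  by rewrite ?in_itv/=; apply/andP; split; lra.
have small a b : a \in `[p - k1, p + k1] -> b \in `[p - k1, p + k1] -> `|a - b| <= 1 / 2.
  rewrite !in_itv/= => /andP[? ?] /andP[? ?].
  by rewrite ler_norml; apply/andP; split; lra.
pose gap (ij : I * I) := `|tt ij.1 - tt ij.2| - (rho (tt ij.1) + rho (tt ij.2)).
pose d0 := \big[Num.min/1]_(ij : I * I | ij.1 != ij.2) gap ij.
have d00 : 0 < d0.
  apply: lt_bigmin => // -[i j] /= ij; rewrite /gap subr_gt0 /=.
  by apply: Dsep => //; exact: tt_inj.
apply: (@separated_images_hausdorff_measure_neq0 R (circle R) A L I phi sigma d0 s' s
  (Ordinal size1) (Ordinal size2) (proj p)) => //.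
- by move=> x [].
- split => //; exists p => //=; rewrite in_itv/=; lra.
- move=> i x [Lx [a aI ax]]; have [E _ FI] := Fball i a aI; have [_ _ Gi _] := good i.
  split; first by rewrite -(iL _ Gi); exists x.
  by rewrite -ax -E; exists (F i a).
- move=> i x y [_ [a aI <-]] [_ [b bI <-]].
  have [Ea _ FaI] := Fball i a aI; have [Eb _ FbI] := Fball i b bI.
  rewrite -Ea -Eb (mdist_projE (small _ _ FaI FbI)).
  apply: le_trans (_ : sigma i * `|a - b| <= _).
    by apply: ler_wpM2l; [exact: ltW|exact: mdist_proj_le].
  have [_ [_ _ lF hF] _ _] := good i; have dF := group_lift_pos_derivable hG lF.
  have key u w : u \in `[p - k1, p + k1] -> w \in `[p - k1, p + k1] -> u <= w ->
      sigma i * `|u - w| <= `|F i u - F i w|.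
    move=> uI wI uw; rewrite distrC [leRHS]distrC !ger0_norm ?subr_ge0 ?(pos_derivable_le dF)//.
    have [e eI ->] := pos_derivable_mvt dF uw.
    apply: ler_wpM2r; first by rewrite subr_ge0.
    apply: (hF e _).2; move: uI wI eI; rewrite !in_itv/= => /andP[? ?] /andP[? ?] /andP[? ?].
    by rewrite ltr_norml; apply/andP; split; lra.
  have [ab|/ltW ba] := leP a b; first exact: key.
  by rewrite distrC [leRHS]distrC; exact: key.
- move=> i j x y ij [_ [a aI <-]] [_ [b bI <-]].
  have [Ea Fa FaI] := Fball i a aI; have [Eb Fb FbI] := Fball j b bI.
  rewrite -Ea -Eb (mdist_projE (small _ _ FaI FbI)).
  apply: le_trans (_ : gap (i, j) <= _); first exact: (@bigmin_le_cond _ _ _ 1 (i, j)).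
  rewrite /gap /=.
  have -> : tt i - tt j = - (F i a - tt i) + ((F i a - F j b) + (F j b - tt j)) by ring.
  have h1 := ler_normD (- (F i a - tt i)) ((F i a - F j b) + (F j b - tt j)).
  have h2 := ler_normD (F i a - F j b) (F j b - tt j).
  by rewrite normrN in h1; lra.
- by lra.
Qed.

End Dimension.

Theorem theorem2p23 (R : realType) (G : set (circle R -> circle R))
    (Lambda : set (circle R)) (delta : R)
    (hG : subgroup_Diff2_plus G) (hfg : finitely_generated G)
    (hLambda : exceptional_minimal_set G Lambda)
    (hstar : property_Lambda_star G Lambda)
    (hnu : exists nu : probability (borel_circle R) R,
      [/\ conformal_measure G delta nu, atomless nu
        & supported_on nu Lambda]) :
  delta%:E = hausdorff_dim Lambda.
Proof.
have [nu [nuG nu0 nuL]] := hnu; have [mL _] := hLambda.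
have d0 := conformal_exponent_ge0 hG hfg mL hstar nuG nu0 nuL.
apply/eqP; rewrite eq_le; apply/andP; split.
  apply: le_ereal_inf_tmp => _ [s [s0 Hs] <-]; rewrite lee_fin leNgt; apply/negP => sd.
  exact: (hausdorff_measure_below hG hfg mL hstar nuG nu0 nuL s0 sd).
apply/lee_addgt0Pr => e e0; apply: ereal_inf_lbound; exists (delta + e) => //.
split; first by rewrite addr_ge0// ltW.
by apply: (hausdorff_measure_above hG hfg mL hstar nuG nu0 nuL); rewrite ltrDl.
Qed.
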